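(* For all $z\in\mathbb C$, $$\frac{\psi(z)}{\Gamma(z)}=-e^{2\gamma z}\prod_{k=0}^\infty\left(1-\frac{z}{\alpha_k}\right)e^{\frac{z}{\alpha_k}},$$ where $\gamma$ is the Euler constant and $\alpha_k$ ($k=0,1,2,\dots$) is the $k$th zero of the Digamma function $\psi$ counted from the right (so $\alpha_0=1.461632\dots$ is the unique positive zero of $\psi$). At the non-positive integers the left-hand side is understood as the value of the entire extension of $\psi/\Gamma$.
   Context: $\Gamma$ is the Euler gamma function and $\psi(z)=\Gamma'(z)/\Gamma(z)$, $z\in\mathbb C\setminus\{0,-1,-2,\dots\}$, is the Digamma function. Both have first order poles at the non-positive integers, so the quotient $\psi/\Gamma$ extends to an entire function. It is known that all zeros of $\psi$ are real and simple, and that all of them except one are negative; they are enumerated in decreasing order $\alpha_0>0>\alpha_1>\alpha_2>\cdots$. *)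

(* Defs.v *)
From HB Require Import structures.
From mathcomp Require Import all_boot all_order all_algebra complex.
From mathcomp Require Import all_classical all_reals all_analysis.
Import Order.TTheory GRing.Theory Num.Theory.
Import numFieldNormedType.Exports.

Set Implicit Arguments.
Unset Strict Implicit.
Unset Printing Implicit Defensive.

Local Open Scope classical_set_scope.
Local Open Scope ring_scope.

(* The type R[i] itself carries no topology; that of an abstract numeric field
   (given by the modulus) is found once R[i] is packaged as a structure. *)
Definition Cplx (R : realType) : numClosedFieldType := R[i].

Section Digamma.
Variable R : realType.
Local Notation C := (Cplx R).

Definition RtoC (x : R) : C := real_complex R x.

Definition cexp (z : C) : C :=
  RtoC (expR (complex.Re z)) *
  (Complex (cos (complex.Im z)) (sin (complex.Im z)) : C).

Definition euler_gamma : R :=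
  limn (fun n : nat => (\sum_(1 <= k < n.+1) k%:R^-1) - ln n%:R : R).

Definition nonpos_int (z : C) : Prop := exists n : nat, z = - n%:R.

(* Euler's limit n! n^z / (z (z + 1) ... (z + n)), with
   n^z = exp (z ln n).  It converges at every z that is not a non-positive
   integer; at the non-positive integers (where x / 0 = 0 makes it 0) the value
   is never used. *)
Definition Gamma (z : C) : C :=
  limn (fun n : nat =>
    n`!%:R * cexp (z * RtoC (ln n%:R)) / \prod_(k < n.+1) (z + k%:R) : C).

Definition digamma (z : C) : C := derive1 Gamma z / Gamma z.

Definition digamma_zeros : set C :=
  [set w : C | ~ nonpos_int w /\ digamma w = 0].

(* alpha_k: the unique strictly decreasing sequence of real numbers whose terms
   are exactly the complex zeros of digamma. *)
Definition digamma_zero : nat -> R :=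
  get [set a : nat -> R |
    (forall k : nat, a k.+1 < a k) /\
    range (fun k : nat => RtoC (a k)) = digamma_zeros].

(* The unique entire function that agrees with digamma / Gamma off the
   non-positive integers. *)
Definition digamma_div_Gamma : C -> C :=
  get [set F : C -> C |
    (forall z : C, derivable F z 1) /\
    (forall z : C, ~ nonpos_int z -> F z = digamma z / Gamma z)].

End Digamma.

(* Main.v *)
(* Write G_n(z) = z (z + 1) ... (z + n) / (n! n^z), so that Gamma = lim 1/G_n.  With
   G = 1/Gamma = lim G_n one has psi/Gamma = - G', so the claim is a product formula
   for G'.  Now G_n'(z) = Q_n(z) / (n! n^z), where Q_n is a real polynomial of degree
   n + 1 whose roots are all real: sign changes of sum_j 1/(x + j) - ln n locate a
   root a_{0,n} in [1, 4] and a root a_{k,n} in (-k, -k + 1) for 1 <= k <= n.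
   Comparing the coefficients of degree 0 and 1 of Q_n gives
     G_n'(z) = e^{2 (H_n - ln n) z} prod_{k <= n} (1 - z/a_{k,n}) e^{z/a_{k,n}}.
   Along an ultrafilter refining n -> oo every a_{k,n} converges, and dominated
   convergence for products yields
     G'(z) = e^{2 gamma z} prod_k (1 - z/a_k) e^{z/a_k}.
   The quadratic remainders of G_n are bounded uniformly on disks, so differentiation
   and limit commute.  Since a convergent product vanishes only where a factor does,
   the a_k are exactly the zeros of psi, and they are decreasing by their location. *)
Require Import Defs.
From HB Require Import structures.
From mathcomp Require Import all_boot all_order all_algebra complex polyrcf.
From mathcomp Require Import all_classical all_reals all_analysis.
From mathcomp Require Import ring lra.
Import Order.TTheory GRing.Theory Num.Theory.
Import numFieldNormedType.Exports.

Set Implicit Arguments.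
Unset Strict Implicit.
Unset Printing Implicit Defensive.

Local Open Scope classical_set_scope.
Local Open Scope ring_scope.

(** * Taylor bounds for the real exponential, sine and cosine *)

Section RealBounds.
Variable R : realType.
Implicit Types a b x : R.

(** Multiplying [1 - a <= expR (- a)] by [expR a] gives the upper bound [expR a - 1 <= a * expR a];
    the tangent line gives the lower one. *)
Lemma expR_sub1_le a : `|expR a - 1| <= `|a| * expR `|a|.
Proof.
have h1 := expR_ge1Dx a; have h2 := expR_ge1Dx (- a).
have e0 := expR_gt0 a; have eN : expR a * expR (- a) = 1 by rewrite expRxMexpNx_1.
have h3 : expR a - 1 <= a * expR a by nra.
have h4 : 1 <= expR `|a| by rewrite -expR0 ler_expR.
have [a0|a0] := lerP 0 a.
  by rewrite (ger0_norm a0) ger0_norm; lra.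
rewrite (ltr0_norm a0) in h4 *.
rewrite ler0_norm; first by nra.
by have : expR a <= 1 by [rewrite expR_le1 ltW]; lra.
Qed.

Lemma expR_sub1x_le a : `|expR a - 1 - a| <= a ^+ 2 * expR `|a|.
Proof.
have h1 := expR_ge1Dx a; have h2 := expR_ge1Dx (- a).
have e0 := expR_gt0 a; have eN : expR a * expR (- a) = 1 by rewrite expRxMexpNx_1.
have h3 : expR a - 1 <= a * expR a by nra.
have h4 : 1 <= expR `|a| by rewrite -expR0 ler_expR.
rewrite ger0_norm; last by lra.
have [a0|a0] := lerP 0 a; first by rewrite (ger0_norm a0); nra.
by nra.
Qed.

Lemma sin_le_norm x : `|sin x| <= `|x|.
Proof.
wlog x0 : x / 0 <= x => [H|].
  have [/H//|x0] := lerP 0 x.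
  by have := H (- x); rewrite sinN !normrN oppr_ge0 => -> //; apply: ltW.
have [|c _] := @MVT_segment R sin cos 0 x x0.
  by apply: continuous_subspaceT => y; apply: continuous_sin.
rewrite sin0 !subr0 => ->; rewrite normrM ler_piMl //; exact: cos_max.
Qed.

Lemma cos_sub1_le_norm x : `|cos x - 1| <= `|x|.
Proof.
wlog x0 : x / 0 <= x => [H|].
  have [/H//|x0] := lerP 0 x.
  by have := H (- x); rewrite cosN !normrN oppr_ge0 => -> //; apply: ltW.
have [|c _] := @MVT_segment R cos (fun y => - sin y) 0 x x0.
  by apply: continuous_subspaceT => y; apply: continuous_cos.
rewrite cos0 !subr0 => ->; rewrite normrM normrN ler_piMl //; exact: sin_max.
Qed.

(** By the half-angle formula [1 - cos x] is twice the square of [sin (x / 2)]. *)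
Lemma cos_sub1_le x : `|cos x - 1| <= x ^+ 2.
Proof.
have -> : cos x - 1 = - (sin (x / 2) ^+ 2 *+ 2).
  by rewrite {1}(splitr x) -mulr2n cos_mulr2n sin2cos2; lra.
have h := sin_le_norm (x / 2).
rewrite normrN ger0_norm ?mulrn_wge0 ?sqr_ge0 //.
have : sin (x / 2) ^+ 2 <= (x / 2) ^+ 2.
  rewrite -(real_normK (num_real (sin _))) -(real_normK (num_real (x / 2))).
  by rewrite lerXn2r ?nnegrE ?normr_ge0.
have -> : (x / 2) ^+ 2 = x ^+ 2 / 4 by field.
by rewrite mulr2n; have := sqr_ge0 x; lra.
Qed.

Lemma sin_subx_le x : `|sin x - x| <= x ^+ 2.
Proof.
wlog x0 : x / 0 <= x => [H|].
  have [/H//|x0] := lerP 0 x.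
  have := H (- x); rewrite sinN sqrrN oppr_ge0 -opprD normrN => -> //; exact: ltW.
have [|c] := @MVT_segment R (fun y => sin y - y) (fun y => cos y - 1) 0 x x0.
  by apply: continuous_subspaceT => y; apply: cvgB; [apply: continuous_sin|].
rewrite in_itv/= => /andP[c0 cx].
rewrite sin0 !subr0 => ->; rewrite normrM (ger0_norm x0) expr2 ler_wpM2r //.
by apply: le_trans (cos_sub1_le_norm c) _; rewrite ger0_norm.
Qed.

End RealBounds.

(** * The real-valued modulus and the complex exponential *)

Section ComplexNorm.
Variable R : realType.
Local Notation C := (Cplx R).

(* The norm of [Cplx R] takes its values in [Cplx R]; [nm] is the same modulus as
   an element of [R]. *)
Definition nm (z : C) : R := ComplexField.Normc.normc z.

Lemma normE (z : C) : `|z| = RtoC (nm z). Proof. by []. Qed.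
Lemma nm0 : nm 0 = 0. Proof. exact: ComplexField.Normc.normc0. Qed.
Lemma nm1 : nm 1 = 1. Proof. exact: ComplexField.Normc.normc1. Qed.
Lemma nm_eq0 z : nm z = 0 -> z = 0. Proof. exact: ComplexField.Normc.eq0_normc. Qed.
Lemma nmM z w : nm (z * w) = nm z * nm w. Proof. exact: ComplexField.Normc.normcM. Qed.
Lemma nmV z : nm z^-1 = (nm z)^-1. Proof. exact: ComplexField.Normc.normcV. Qed.
Lemma nmN z : nm (- z) = nm z. Proof. exact: normcN. Qed.
Lemma nmD z w : nm (z + w) <= nm z + nm w. Proof. exact: le_normcD. Qed.
Lemma nmB z w : nm (z - w) <= nm z + nm w. Proof. by rewrite -(nmN w) nmD. Qed.
Lemma nmC z w : nm (z - w) = nm (w - z). Proof. by rewrite -nmN opprB. Qed.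
Lemma nm_ge0 z : 0 <= nm z. Proof. by case: z => a b; rewrite /nm /= sqrtr_ge0. Qed.
Lemma nm_gt0 z : z <> 0 -> 0 < nm z.
Proof. by move=> z0; rewrite lt_neqAle nm_ge0 andbT eq_sym; apply/eqP => /nm_eq0. Qed.
Lemma nm_tri z w v : nm (z - w) <= nm (z - v) + nm (v - w).
Proof. by apply: le_trans (nmD _ _); rewrite addrA subrK. Qed.

Lemma RtoCD (a b : R) : RtoC (a + b) = RtoC a + RtoC b. Proof. exact: rmorphD. Qed.
Lemma RtoCB (a b : R) : RtoC (a - b) = RtoC a - RtoC b. Proof. exact: rmorphB. Qed.
Lemma RtoCM (a b : R) : RtoC (a * b) = RtoC a * RtoC b. Proof. exact: rmorphM. Qed.
Lemma RtoCV (a : R) : RtoC a^-1 = (RtoC a)^-1. Proof. exact: fmorphV. Qed.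
Lemma RtoCN (a : R) : RtoC (- a) = - RtoC a. Proof. exact: rmorphN. Qed.
Lemma RtoC0 : RtoC (0 : R) = 0. Proof. by []. Qed.
Lemma RtoC1 : RtoC (1 : R) = 1. Proof. by []. Qed.
Lemma RtoCn n : RtoC (n%:R : R) = n%:R. Proof. exact: rmorph_nat. Qed.
Lemma RtoC_inj : injective (@RtoC R). Proof. by move=> a b []. Qed.
Lemma nmR (a : R) : nm (RtoC a) = `|a|.
Proof. by rewrite /nm /RtoC /= expr0n addr0 sqrtr_sqr. Qed.

Lemma nm_le_ReIm (z : C) : nm z <= `|complex.Re z| + `|complex.Im z|.
Proof.
case: z => a b; have -> : Complex a b = RtoC a + Complex 0 1 * RtoC b :> C.
  by apply/eqP; rewrite eq_complex /= !(mul0r,mulr0,mul1r,subr0,addr0,add0r) !eqxx.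
apply: le_trans (nmD _ _) _; rewrite nmM !nmR /nm /= expr0n expr1n add0r sqrtr1 mul1r.
by rewrite !(mul0r,mulr0,mul1r,subr0,addr0,add0r).
Qed.

Lemma Re_le_nm (z : C) : `|complex.Re z| <= nm z.
Proof. by case: z => a b; rewrite /nm /= -sqrtr_sqr ler_wsqrtr // lerDl sqr_ge0. Qed.

Lemma Im_le_nm (z : C) : `|complex.Im z| <= nm z.
Proof. by case: z => a b; rewrite /nm /= -sqrtr_sqr ler_wsqrtr // lerDr sqr_ge0. Qed.

Lemma cexpD (z w : C) : cexp (z + w) = cexp z * cexp w.
Proof.
case: z w => a b [c d]; rewrite /cexp /= expRD RtoCM cosD sinD.
rewrite mulrACA; congr (_ * _).
by apply/eqP; rewrite eq_complex /= eqxx [X in _ == X]addrC eqxx.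
Qed.

Lemma cexp0 : cexp (0 : C) = 1.
Proof. by rewrite /cexp /= expR0 cos0 sin0 RtoC1 mul1r. Qed.

Lemma nm_cexp (z : C) : nm (cexp z) = expR (complex.Re z).
Proof.
rewrite nmM nmR ger0_norm ?expR_ge0 // /nm /= cos2Dsin2.
by rewrite sqrtr1 mulr1.
Qed.

Lemma nm_cexp_le (z : C) : nm (cexp z) <= expR (nm z).
Proof. by rewrite nm_cexp ler_expR; apply: le_trans (Re_le_nm _); apply: ler_norm. Qed.

Lemma cexp_neq0 (z : C) : cexp z != 0.
Proof.
apply/eqP => h; have := nm_cexp z; rewrite h nm0 => /esym/eqP.
by rewrite expR_eq0.
Qed.

Lemma cexpN (z : C) : cexp (- z) = (cexp z)^-1.
Proof.
by apply: (mulfI (cexp_neq0 z)); rewrite -cexpD subrr cexp0 divff ?cexp_neq0.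
Qed.

(** With [h = a + ib], the real and imaginary parts of the remainder split into one-variable
    remainders and cross terms; they are bounded by 2 and 3 times [expR (nm h) * nm h ^+ 2], whence
    the 5. *)
Lemma cexp_sub1x_le (h : C) : nm (cexp h - 1 - h) <= 5 * expR (nm h) * nm h ^+ 2.
Proof.
have ha := Re_le_nm h; have hb := Im_le_nm h; have n0 := nm_ge0 h.
apply: le_trans (nm_le_ReIm _) _.
move: (nm h) ha hb n0 => n; case: h => a b /= ha hb n0.
have E0 : expR `|a| <= expR n by rewrite ler_expR.
have E1 := expR_ge0 `|a|; have E2 : expR a <= expR `|a| by rewrite ler_expR ler_norm.
have e1 := expR_sub1_le a; have e2 := expR_sub1x_le a.
have c1 := cos_sub1_le b; have s1 := sin_subx_le b.
have A0 := normr_ge0 a; have B0 := normr_ge0 b; have e0 := expR_ge0 a.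
have q1 : a ^+ 2 <= n ^+ 2 by rewrite -(real_normK (num_real a)) lerXn2r ?nnegrE.
have q2 : b ^+ 2 <= n ^+ 2 by rewrite -(real_normK (num_real b)) lerXn2r ?nnegrE.
have q3 : `|a| * `|b| <= n ^+ 2 by nra.
have q0 : 0 <= n ^+ 2 by rewrite exprn_ge0.
have p1 : `|expR a * cos b - 0 * sin b - 1 - a| <= 2 * (expR n * n ^+ 2).
  have -> : expR a * cos b - 0 * sin b - 1 - a =
            (expR a - 1 - a) + expR a * (cos b - 1) by ring.
  apply: le_trans (ler_normD _ _) _; rewrite normrM (ger0_norm e0).
  have : a ^+ 2 * expR `|a| <= expR n * n ^+ 2.
    by rewrite mulrC ler_pM // sqr_ge0.
  have : expR a * `|cos b - 1| <= expR n * n ^+ 2.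
    by rewrite ler_pM // ?(le_trans c1) // (le_trans E2).
  by lra.
have p2 : `|expR a * sin b + 0 * cos b - 0 - b| <= 3 * (expR n * n ^+ 2).
  have -> : expR a * sin b + 0 * cos b - 0 - b =
            expR a * (sin b - b) + b * (expR a - 1) by ring.
  apply: le_trans (ler_normD _ _) _; rewrite !normrM (ger0_norm e0).
  have : expR a * `|sin b - b| <= expR n * n ^+ 2.
    by rewrite ler_pM // ?(le_trans s1) // (le_trans E2).
  have : `|b| * `|expR a - 1| <= expR n * n ^+ 2.
    apply: le_trans (_ : `|b| * (`|a| * expR `|a|) <= _); first by rewrite ler_wpM2l.
    by rewrite mulrA mulrC ler_pM // ?mulr_ge0 // mulrC.
  by have : 0 <= expR n * n ^+ 2; [rewrite mulr_ge0 // expR_ge0 | lra].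
by rewrite -mulrA; apply: le_trans (lerD p1 p2) _; lra.
Qed.

Lemma cexp_sub1_le (h : C) : nm (cexp h - 1) <= 5 * expR (nm h) * (nm h ^+ 2 + nm h).
Proof.
have -> : cexp h - 1 = (cexp h - 1 - h) + h by rewrite subrK.
apply: le_trans (nmD _ _) _.
have h0 := nm_ge0 h; have h1 := cexp_sub1x_le h.
have : 1 <= expR (nm h) by rewrite -expR0 ler_expR.
by nra.
Qed.

End ComplexNorm.

(** * Complex limits expressed through the real modulus *)

Section ComplexLimits.
Variable R : realType.
Local Notation C := (Cplx R).

Lemma RtoC_le (a b : R) : (RtoC a <= RtoC b) = (a <= b).
Proof. exact: lecR. Qed.

(** A positive element of [Cplx R] has imaginary part 0, so the epsilon of the norm topology may be
    taken real. *)
Lemma cvg_nmP T (F : set_system T) (FF : Filter F) (f : T -> C) (l : C) :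
  f @ F --> l <-> forall e : R, 0 < e -> \forall t \near F, nm (l - f t) <= e.
Proof.
rewrite cvgrPdist_le; split => H e e0.
  have := H (RtoC e); rewrite -[X in X < _]RtoC0 ltcR => /(_ e0).
  by apply: filterS => t; rewrite normE RtoC_le.
have [a a0 ->] : exists2 a, 0 < a & e = RtoC a.
  case: e e0 => a b; rewrite ltcE /= => /andP[b0 a0]; exists a => //.
  by apply/eqP; rewrite eq_complex /= eqxx.
by apply: filterS (H _ a0) => t; rewrite normE RtoC_le.
Qed.

Lemma RtoC_cvg T (F : set_system T) (FF : Filter F) (f : T -> R) (l : R) :
  f @ F --> l -> (fun t => RtoC (f t)) @ F --> RtoC l.
Proof.
move=> /cvgrPdist_le H; apply/cvg_nmP => e e0.
by apply: filterS (H _ e0) => t; rewrite -RtoCB nmR.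
Qed.

Lemma nm_lim_le T (F : set_system T) (FF : ProperFilter F) (f : T -> C) (l : C) B :
  f @ F --> l -> (\forall t \near F, nm (f t) <= B) -> nm l <= B.
Proof.
move=> /cvg_nmP H HB; apply/ler_addgt0Pr => e e0.
have [t [h1 h2]] := filter_ex (filterI (H _ e0) HB).
have := nmD (l - f t) (f t); rewrite subrK => /le_trans; apply.
by rewrite addrC lerD.
Qed.

(** Real and imaginary parts are 1-Lipschitz for the modulus, so completeness is inherited from [R]
    coordinate by coordinate. *)
Lemma cauchyC_cvg (u : nat -> C) :
  (forall e : R, 0 < e ->
    exists N, forall m n, (N <= m)%N -> (N <= n)%N -> nm (u m - u n) <= e) ->
  exists l : C, u @ \oo --> l.
Proof.
move=> H.
have P (p : C -> R) : (forall z w, `|p z - p w| <= nm (z - w)) ->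
    exists l : R, (fun n => p (u n)) @ \oo --> l.
  move=> hp; apply/cvg_ex; apply/cauchy_cvgP; apply: cauchy_exP => e e0.
  have e2 : 0 < e / 2 by rewrite divr_gt0.
  have [N HN] := H _ e2; exists (p (u N)).
  exists N => // n /= Nn; rewrite /ball /=; apply: le_lt_trans (hp _ _) _.
  by apply: le_lt_trans (HN _ _ _ _) _ => //; rewrite ltr_pdivrMr // ltr_pMr // ltr1n.
have [|a Ha] := P (@complex.Re R).
  by move=> [a b] [c d]; apply: (Re_le_nm (Complex a b - Complex c d)).
have [|b Hb] := P (@complex.Im R).
  by move=> [a' b] [c d]; apply: (Im_le_nm (Complex a' b - Complex c d)).
exists (Complex a b); apply/cvg_nmP => e e0.
have e2 : 0 < e / 2 by rewrite divr_gt0.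
move/cvgrPdist_le: Ha => /(_ _ e2); move/cvgrPdist_le: Hb => /(_ _ e2) Hb Ha.
near=> n; apply: le_trans (nm_le_ReIm _) _.
have h1 : `|a - complex.Re (u n)| <= e / 2 by near: n.
have h2 : `|b - complex.Im (u n)| <= e / 2 by near: n.
case: (u n) h1 h2 => x y /= h1 h2; rewrite [leRHS]splitr; exact: lerD.
Unshelve. all: by end_near. Qed.

End ComplexLimits.

(** * Uniform first-order Taylor bounds on disks *)

Section Jets.
Variable R : realType.
Local Notation C := (Cplx R).
Implicit Types (r K e : R) (f g : C -> C) (z w : C).

(* [f] has derivative [f1] on the disk of radius [r], with value, Lipschitz and
   quadratic remainder bounds all at most [K].  Such bounds are stable under sums,
   products and pointwise limits, and replace Cauchy estimates. *)
Definition jet r K f f1 :=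
  [/\ forall z, nm z <= r -> nm (f z) <= K,
      forall z, nm z <= r -> nm (f1 z) <= K,
      forall z w, nm z <= r -> nm w <= r -> nm (f w - f z) <= K * nm (w - z) &
      forall z w, nm z <= r -> nm w <= r ->
        nm (f w - f z - (w - z) * f1 z) <= K * nm (w - z) ^+ 2].

Lemma jet_ext r K f f1 g g1 : f =1 g -> f1 =1 g1 -> jet r K f f1 -> jet r K g g1.
Proof. by move=> /funext -> /funext ->. Qed.

Lemma jet_le r K K' f f1 : K <= K' -> jet r K f f1 -> jet r K' f f1.
Proof.
move=> KK [a b c d]; split => [z zr|z zr|z w zr wr|z w zr wr].
- exact: le_trans (a _ zr) KK.
- exact: le_trans (b _ zr) KK.
- by apply: le_trans (c _ _ zr wr) _; rewrite ler_wpM2r ?nm_ge0.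
- by apply: le_trans (d _ _ zr wr) _; rewrite ler_wpM2r ?exprn_ge0 ?nm_ge0.
Qed.

Lemma jet_cst r (c : C) : jet r (nm c) (fun=> c) (fun=> 0).
Proof.
split => [//|z _|z w _ _|z w _ _].
- by rewrite nm0 nm_ge0.
- by rewrite subrr nm0 mulr_ge0 ?nm_ge0.
- by rewrite mulr0 !subrr nm0 mulr_ge0 ?exprn_ge0 ?nm_ge0.
Qed.

Lemma jet_id r : 0 <= r -> jet r (r + 1) id (fun=> 1).
Proof.
move=> r0; have h : 1 <= r + 1 by rewrite lerDr.
split => [z zr|z _|z w _ _|z w _ _].
- by rewrite (le_trans zr) // lerDl.
- by rewrite nm1.
- by rewrite -[leLHS]mul1r ler_wpM2r ?nm_ge0.
- by rewrite mulr1 subrr nm0 mulr_ge0 ?exprn_ge0 ?nm_ge0 // (le_trans _ h).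
Qed.

Lemma jet_add r K K' f f1 g g1 : jet r K f f1 -> jet r K' g g1 ->
  jet r (K + K') (fun z => f z + g z) (fun z => f1 z + g1 z).
Proof.
move=> [a b c d] [a' b' c' d']; split => [z zr|z zr|z w zr wr|z w zr wr].
- by apply: le_trans (nmD _ _) _; rewrite lerD ?a ?a'.
- by apply: le_trans (nmD _ _) _; rewrite lerD ?b ?b'.
- have -> : f w + g w - (f z + g z) = (f w - f z) + (g w - g z) by ring.
  by apply: le_trans (nmD _ _) _; rewrite mulrDl lerD ?c ?c'.
- have -> : f w + g w - (f z + g z) - (w - z) * (f1 z + g1 z) =
    (f w - f z - (w - z) * f1 z) + (g w - g z - (w - z) * g1 z) by ring.
  by apply: le_trans (nmD _ _) _; rewrite [leRHS]mulrDl lerD ?d ?d'.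
Qed.

(** The factor 3 counts the terms of the quadratic remainder of a product: one remainder for each
    factor, and the cross term of derivative and increment. *)
Lemma jet_mul r K K' f f1 g g1 : jet r K f f1 -> jet r K' g g1 ->
  jet r (3 * K * K') (fun z => f z * g z) (fun z => f1 z * g z + f z * g1 z).
Proof.
move=> [a b c d] [a' b' c' d']; split => [z zr|z zr|z w zr wr|z w zr wr].
- rewrite nmM; have := a _ zr; have := a' _ zr.
  have := nm_ge0 (f z); have := nm_ge0 (g z); nra.
- apply: le_trans (nmD _ _) _; rewrite !nmM.
  have := a _ zr; have := a' _ zr; have := b _ zr; have := b' _ zr.
  have := nm_ge0 (f z); have := nm_ge0 (g z).
  have := nm_ge0 (f1 z); have := nm_ge0 (g1 z) => p1 p2 p3 p4 q1 q2 q3 q4.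
  have : nm (f1 z) * nm (g z) <= K * K' by rewrite ler_pM.
  have : nm (f z) * nm (g1 z) <= K * K' by rewrite ler_pM.
  have K0 : 0 <= K by apply: le_trans (nm_ge0 _) (a _ zr).
  have K0' : 0 <= K' by apply: le_trans (nm_ge0 _) (a' _ zr).
  by have : 0 <= K * K'; [rewrite mulr_ge0|lra].
- have -> : f w * g w - f z * g z = (f w - f z) * g w + f z * (g w - g z) by ring.
  apply: le_trans (nmD _ _) _; rewrite !nmM.
  have h1 := c _ _ zr wr; have h2 := c' _ _ zr wr; have h3 := a _ zr; have h4 := a' _ wr.
  have p0 := nm_ge0 (w - z); have p1 := nm_ge0 (f z); have p2 := nm_ge0 (g w).
  have K0 : 0 <= K by apply: le_trans h3.
  have K0' : 0 <= K' by apply: le_trans h4.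
  have : nm (f w - f z) * nm (g w) <= K * nm (w - z) * K' by rewrite ler_pM ?nm_ge0.
  have : nm (f z) * nm (g w - g z) <= K * (K' * nm (w - z)) by rewrite ler_pM ?nm_ge0.
  by have : 0 <= K * K' * nm (w - z); [rewrite !mulr_ge0|lra].
- have -> : f w * g w - f z * g z - (w - z) * (f1 z * g z + f z * g1 z) =
    (f w - f z - (w - z) * f1 z) * g w + (w - z) * f1 z * (g w - g z)
      + f z * (g w - g z - (w - z) * g1 z) by ring.
  apply: le_trans (nmD _ _) _; apply: le_trans (lerD (nmD _ _) (lexx _)) _.
  rewrite !nmM; have h3 := a _ zr; have h4 := a' _ wr; have h5 := b _ zr.
  have h1 := d _ _ zr wr; have h2 := d' _ _ zr wr; have h6 := c' _ _ zr wr.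
  have p0 := nm_ge0 (w - z); have p1 := nm_ge0 (f z); have p2 := nm_ge0 (g w).
  have K0 : 0 <= K by apply: le_trans h3.
  have K0' : 0 <= K' by apply: le_trans h4.
  set n := nm (w - z) in h1 h2 h6 p0 *.
  have q1 : nm (f w - f z - (w - z) * f1 z) * nm (g w) <= K * n ^+ 2 * K'.
    by rewrite ler_pM ?nm_ge0.
  have q2 : nm (f z) * nm (g w - g z - (w - z) * g1 z) <= K * (K' * n ^+ 2).
    by rewrite ler_pM ?nm_ge0.
  have q3 : n * nm (f1 z) * nm (g w - g z) <= n * K * (K' * n).
    by rewrite ler_pM ?mulr_ge0 ?nm_ge0 // ler_wpM2l.
  by have -> : 3 * K * K' * n ^+ 2 = K * n ^+ 2 * K' + n * K * (K' * n) + K * (K' * n ^+ 2);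
    [ring|rewrite !lerD].
Qed.

(** The functional equation moves the base point to 0, where the remainder of the exponential is
    already bounded. *)
Lemma jet_cexp r : exists2 K, 0 <= K & jet r K (@cexp R) (@cexp R).
Proof.
set A := expR r; set B := 5 * expR (2 * r).
have A1 : 0 <= A := expR_ge0 _; have B1 : 0 <= B by rewrite mulr_ge0 ?expR_ge0.
have r2 z w : nm z <= r -> nm w <= r -> nm (w - z) <= 2 * r.
  by move=> h1 h2; have := nmB w z; lra.
have hB z w : nm z <= r -> nm w <= r -> 5 * expR (nm (w - z)) <= B.
  by move=> h1 h2; rewrite ler_wpM2l // ler_expR r2.
have hA z : nm z <= r -> nm (cexp z) <= A.
  by move=> h; apply: le_trans (nm_cexp_le _) _; rewrite ler_expR.
(* A disk of negative radius is empty. *)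
have [r0|r0] := lerP 0 r; last first.
  exists 0 => //; split => [z zr|z zr|z w zr|z w zr]; have := nm_ge0 z; lra.
have M0 : 0 <= A * B * (2 * r + 1) by rewrite !mulr_ge0 ?addr_ge0 ?mulr_ge0.
exists (A + A * B * (2 * r + 1)); first by rewrite addr_ge0.
split => [z zr|z zr|z w zr wr|z w zr wr].
- by apply: le_trans (hA _ zr) _; rewrite lerDl.
- by apply: le_trans (hA _ zr) _; rewrite lerDl.
- have -> : cexp w - cexp z = cexp z * (cexp (w - z) - 1).
    by rewrite mulrBr mulr1 -cexpD [z + _]addrC subrK.
  rewrite nmM; have := cexp_sub1_le (w - z).
  have := hB _ _ zr wr; have := r2 _ _ zr wr; have n0 := nm_ge0 (w - z).
  move: (nm (w - z)) n0 (5 * _) => n n0 E n2 EB h1.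
  have h2 : E * (n ^+ 2 + n) <= B * ((2 * r + 1) * n).
    apply: le_trans (_ : B * (n ^+ 2 + n) <= _).
      by rewrite ler_wpM2r // addr_ge0 // exprn_ge0.
    by rewrite ler_wpM2l // expr2; nra.
  apply: le_trans (_ : A * (B * ((2 * r + 1) * n)) <= _).
    by rewrite ler_pM ?nm_ge0 ?hA // (le_trans h1).
  by rewrite [leRHS]mulrDl !mulrA lerDr mulr_ge0.
- have -> : cexp w - cexp z - (w - z) * cexp z = cexp z * (cexp (w - z) - 1 - (w - z)).
    by rewrite !mulrBr mulr1 -cexpD [z + _]addrC subrK; ring.
  rewrite nmM; have h1 := cexp_sub1x_le (w - z).
  have h2 := hB _ _ zr wr; have n0 := nm_ge0 (w - z).
  apply: le_trans (_ : A * (B * nm (w - z) ^+ 2) <= _).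
    rewrite ler_pM ?nm_ge0 ?hA // (le_trans h1) // ler_wpM2r ?exprn_ge0 //.
  rewrite mulrA ler_wpM2r ?exprn_ge0 //.
  apply: le_trans (_ : A * B * (2 * r + 1) <= _); last by rewrite lerDr.
  by rewrite ler_peMr ?mulr_ge0 // lerDr mulr_ge0.
Qed.

(** Under [z |-> c * z] values are unchanged, derivatives and Lipschitz constants gain [B],
    quadratic remainders gain [B ^+ 2]; the sum covers all of them. *)
Lemma jet_scale r s K B (c : C) f f1 : 0 <= K -> nm c <= B -> B * r <= s ->
  jet s K f f1 ->
  jet r (K * (1 + B + B ^+ 2)) (fun z => f (c * z)) (fun z => c * f1 (c * z)).
Proof.
move=> K0 cB Brs [a b c' d]; have c0 := nm_ge0 c; have B0 := le_trans c0 cB.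
have sz z : nm z <= r -> nm (c * z) <= s.
  by move=> h; rewrite nmM (le_trans _ Brs) // ler_pM ?nm_ge0.
have BB : 0 <= B ^+ 2 by rewrite exprn_ge0.
split => [z zr|z zr|z w zr wr|z w zr wr].
- by apply: le_trans (a _ (sz _ zr)) _; rewrite ler_peMr //; lra.
- rewrite nmM mulrC; apply: le_trans (_ : K * B <= _); last by rewrite ler_wpM2l //; lra.
  by rewrite ler_pM ?nm_ge0 ?b ?sz.
- apply: le_trans (c' _ _ (sz _ zr) (sz _ wr)) _; rewrite -mulrBr nmM mulrA.
  rewrite ler_wpM2r ?nm_ge0 // ler_wpM2l //; lra.
- have -> : (w - z) * (c * f1 (c * z)) = (c * w - c * z) * f1 (c * z) by ring.
  apply: le_trans (d _ _ (sz _ zr) (sz _ wr)) _; rewrite -mulrBr nmM exprMn mulrA.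
  rewrite ler_wpM2r ?exprn_ge0 ?nm_ge0 // ler_wpM2l //.
  have : nm c ^+ 2 <= B ^+ 2 by rewrite lerXn2r ?nnegrE.
  by lra.
Qed.

(** Weierstrass's primary factor of genus 1; its derivative is [- w * cexp w]. *)
Definition Efac (w : C) : C := (1 - w) * cexp w.

Lemma Efac_jet r : 0 <= r -> exists K, [/\ 0 <= K,
  forall w, nm w <= r -> nm (cexp w) <= K &
  jet r K (fun w => Efac w - 1) (fun w => - w * cexp w)].
Proof.
move=> r0; have [K K0 HK] := jet_cexp r.
have h := jet_add (jet_mul (jet_add (jet_cst r 1) (jet_mul (jet_cst r (-1)) (jet_id r0))) HK)
  (jet_cst r (-1)).
set K' := _ + _ in h; have K0' : 0 <= K'.
  by rewrite /K' nmN nm1 !(mulr_ge0, addr_ge0).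
exists (K + K'); split; first by rewrite addr_ge0.
  by move=> w wr; case: HK => /(_ w wr) h1 _ _ _; apply: (le_trans h1); rewrite lerDl.
apply: jet_le (jet_ext _ _ h); first by rewrite lerDr.
- by move=> w; rewrite /Efac; ring.
- by move=> w; ring.
Qed.

(** [Efac w - 1] vanishes at 0 together with its derivative, so after scaling by [1 / a] every bound
    acquires the factor [1 / a ^+ 2]. With [a] growing linearly in [m] these bounds are summable. *)
Lemma Efac_scaled_jet r : 0 <= r -> exists2 K, 0 <= K &
  forall (a : R) m, m.+1%:R / 8 <= `|a| ->
  jet r (K / m.+1%:R ^+ 2) (fun z => Efac (z / RtoC a) - 1)
        (fun z => (RtoC a)^-1 * (- (z / RtoC a) * cexp (z / RtoC a))).
Proof.
move=> r0; have [K [K0 HE [_ _ _ D]]] := @Efac_jet (8 * r) (mulr_ge0 (ler0n _ _) r0).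
set U := fun w => Efac w - 1 in D *; set U1 := fun w : C => - w * cexp w in D *.
(* The terms [r ^+ 2], [3 * r] and 1 serve the value, Lipschitz and remainder bounds; 64 is the
   square of the 8 in the lower bound on [a]. *)
exists (K * (r ^+ 2 + 3 * r + 1) * 64).
  by rewrite !(mulr_ge0, addr_ge0) // exprn_ge0.
move=> a m ma.
have m0 : 0 < m.+1%:R :> R by rewrite ltr0n.
have m1 : 1 <= m.+1%:R :> R by rewrite ler1n.
have a0 : 0 < `|a| by apply: lt_le_trans ma; rewrite divr_gt0.
pose t := `|a|^-1; have t0 : 0 <= t by rewrite invr_ge0.
have nt z : nm (z / RtoC a) = nm z * t by rewrite nmM nmV nmR.
have t1 : t <= 8 / m.+1%:R.
  by rewrite -[8 / _]invf_div lef_pV2 // posrE divr_gt0.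
have t8 : t <= 8.
  by apply: le_trans t1 _; rewrite ler_pdivrMr // ler_peMr.
have t2 : t ^+ 2 <= 64 / m.+1%:R ^+ 2.
  apply: le_trans (_ : (8 / m.+1%:R) ^+ 2 <= _).
    by rewrite lerXn2r ?nnegrE // divr_ge0.
  by rewrite expr_div_n le_eqVlt; apply/orP; left; apply/eqP; congr (_ / _); ring.
have tt0 : 0 <= t ^+ 2 by rewrite exprn_ge0.
have sz z : nm z <= r -> nm (z / RtoC a) <= 8 * r.
  by move=> h; rewrite nt mulrC ler_pM ?nm_ge0.
have U0 : U 0 = 0 by rewrite /U /Efac cexp0 subr0 mulr1 subrr.
have U10 : U1 0 = 0 by rewrite /U1 oppr0 mul0r.
have U1b z : nm z <= r -> nm (U1 (z / RtoC a)) <= K * r * t.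
  move=> h; rewrite nmM nmN nt mulrC -mulrA.
  by rewrite ler_pM ?mulr_ge0 ?nm_ge0 ?HE ?sz // ler_wpM2r.
have rem z w : nm z <= r -> nm w <= r ->
    nm (U (w / RtoC a) - U (z / RtoC a) - (w / RtoC a - z / RtoC a) * U1 (z / RtoC a))
    <= K * (nm (w - z) ^+ 2 * t ^+ 2).
  move=> hz hw; apply: le_trans (D _ _ (sz _ hz) (sz _ hw)) _.
  by rewrite -mulrBl nt exprMn.
have Kr0 : 0 <= K * r by rewrite mulr_ge0.
have Krr0 : 0 <= K * r ^+ 2 by rewrite mulr_ge0 ?exprn_ge0.
apply: (@jet_le _ (K * (r ^+ 2 + 3 * r + 1) * t ^+ 2)).
  by rewrite -!mulrA ler_wpM2l // ler_wpM2l // !addr_ge0 ?mulr_ge0 ?exprn_ge0.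
split => [z zr|z zr|z w zr wr|z w zr wr].
- have := rem 0 z; rewrite nm0 !mul0r U0 U10 !subr0 mulr0 subr0 => /(_ r0 zr) /le_trans; apply.
  rewrite mulrA ler_wpM2r // ler_wpM2l //.
  have : nm z ^+ 2 <= r ^+ 2 by rewrite lerXn2r ?nnegrE ?nm_ge0.
  lra.
- rewrite nmM nmV nmR -/t; apply: le_trans (_ : t * (K * r * t) <= _).
    by rewrite ler_wpM2l ?U1b.
  rewrite mulrCA -expr2 ler_wpM2r //; lra.
(* The Lipschitz bound of [U] alone would give a single factor [t]; remainder plus linear term gives
   two, since [U1] is small near 0. *)
- have -> : U (w / RtoC a) - U (z / RtoC a) =
      (U (w / RtoC a) - U (z / RtoC a) - (w / RtoC a - z / RtoC a) * U1 (z / RtoC a))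
      + (w - z) / RtoC a * U1 (z / RtoC a) by ring.
  apply: le_trans (nmD _ _) _; apply: le_trans (lerD (rem _ _ zr wr) (lexx _)) _.
  rewrite nmM nt; have n0 := nm_ge0 (w - z).
  have n2 : nm (w - z) <= 2 * r by have := nmB w z; lra.
  have h1 : nm (w - z) * t * nm (U1 (z / RtoC a)) <= nm (w - z) * t * (K * r * t).
    by rewrite ler_wpM2l ?mulr_ge0 ?U1b.
  have h2 : K * (nm (w - z) ^+ 2 * t ^+ 2) <= K * (2 * r * nm (w - z) * t ^+ 2).
    by rewrite ler_wpM2l // ler_wpM2r // expr2 ler_wpM2r.
  apply: le_trans (lerD h2 h1) _.
  rewrite -subr_ge0; set n := nm _ in n0 *.
  have -> : K * (r ^+ 2 + 3 * r + 1) * t ^+ 2 * n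
     - (K * (2 * r * n * t ^+ 2) + n * t * (K * r * t)) = (K * r ^+ 2 + K) * (t ^+ 2 * n) by ring.
  by rewrite mulr_ge0 ?addr_ge0 ?mulr_ge0.
- have -> : (w - z) * ((RtoC a)^-1 * (- (z / RtoC a) * cexp (z / RtoC a))) =
     (w / RtoC a - z / RtoC a) * U1 (z / RtoC a) by rewrite /U1; ring.
  apply: le_trans (rem _ _ zr wr) _.
  rewrite [_ * t ^+ 2]mulrC mulrA ler_wpM2r ?exprn_ge0 ?nm_ge0 // ler_wpM2r //; lra.
Qed.
End Jets.

(** * Infinite products whose factors are 1 + O(1/k^2) *)

Section InfiniteProducts.
Variable R : realType.
Local Notation C := (Cplx R).
Implicit Types (r K e : R) (z w : C).

(** The exponential of the partial sum of [e] is a majorant: one more factor changes the product by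
    at most [expR S * e N], and the majorant grows by at least as much because [1 + x <= expR x]. *)
Lemma prod_dist (u : nat -> C) (e : nat -> R) m n : (m <= n)%N ->
  (forall k, (k < n)%N -> nm (u k) <= e k) ->
  nm (\prod_(k < n) (1 + u k) - \prod_(k < m) (1 + u k))
    <= expR (\sum_(k < n) e k) - expR (\sum_(k < m) e k).
Proof.
move=> /subnK <-; elim: (n - m)%N => [|j IH] ue; first by rewrite !subrr nm0.
rewrite addSn in ue *; have {}IH := IH (fun k h => ue k (ltnW h)).
have uj := ue _ (leqnn (j + m).+1).
set N := (j + m)%N in IH uj ue *; rewrite !(big_ord_recr N) /=.
have P0 : nm (\prod_(k < N) (1 + u k)) <= expR (\sum_(k < N) e k).
  elim: {IH uj} N ue => [|i IHi] ue; first by rewrite !big_ord0 nm1 expR0.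
  have Pi := IHi (fun k ki => ue k (leqW ki)).
  rewrite !big_ord_recr /= nmM expRD ler_pM ?nm_ge0 //.
  apply: le_trans (nmD _ _) _; rewrite nm1; apply: le_trans (expR_ge1Dx _).
  by rewrite lerD2l ue // ltnS.
set P := \prod_(k < N) _ in IH P0 *; set S := \sum_(k < N) _ in IH P0 *.
have -> : P * (1 + u N) - \prod_(k < m) (1 + u k) =
  (P - \prod_(k < m) (1 + u k)) + P * u N by ring.
apply: le_trans (nmD _ _) _; rewrite nmM expRD.
have : nm P * nm (u N) <= expR S * e N by rewrite ler_pM ?nm_ge0.
have : expR S * (1 + e N) <= expR S * expR (e N) by rewrite ler_wpM2l ?expR_ge0 ?expR_ge1Dx.
by lra.
Qed.

(** Telescoping: [K / x ^+ 2 <= 2 * K / x - 2 * K / (x + 1)] for [x >= 1]. *)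
Lemma sum_inv_sqr_le K m n : 0 <= K ->
  \sum_(k < n) K / (m + k).+1%:R ^+ 2 <= 2 * K / m.+1%:R.
Proof.
move=> K0; apply: le_trans (_ : 2 * K / m.+1%:R - 2 * K / (m + n).+1%:R <= _); last first.
  by rewrite gerBl !mulr_ge0.
elim: n => [|n IH]; first by rewrite big_ord0 addn0 subrr.
rewrite big_ord_recr /= addnS; apply: le_trans (lerD IH (lexx _)) _.
have x0 : 1 <= (m + n).+1%:R :> R by rewrite ler1n.
rewrite -[(m + n).+2%:R]natr1; set x := (m + n).+1%:R in x0 *.
have y0 : m.+1%:R != 0 :> R by rewrite pnatr_eq0.
have x1 : x != 0 by lra.
have x2 : x + 1 != 0 by lra.
rewrite -subr_ge0; move: (m.+1%:R) y0 => y y0; clearbody x.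
have -> : 2 * K / y - 2 * K / (x + 1) - (2 * K / y - 2 * K / x + K / x ^+ 2)
  = K * (x - 1) / (x ^+ 2 * (x + 1)).
  by field; rewrite x2 x1.
by rewrite divr_ge0 ?mulr_ge0 ?exprn_ge0 //; lra.
Qed.

(** Restricted to [k < n] because for the n-th approximant only finitely many roots are
    controlled. *)
Definition sqr_bound K (u : nat -> C) n :=
  forall k, (k < n)%N -> nm (u k) <= K / k.+1%:R ^+ 2.

Definition prod_tail K : R := 2 * K * expR (4 * K).

Lemma expR_tail_le K m : 0 <= K ->
  expR (2 * K / m.+1%:R) - 1 <= 2 * K / m.+1%:R * expR (2 * K).
Proof.
move=> K0; have h0 : 0 <= 2 * K / m.+1%:R by rewrite !mulr_ge0.
apply: le_trans (ler_norm _) _; apply: le_trans (expR_sub1_le _) _.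
rewrite ger0_norm // ler_wpM2l // ler_expR ler_pdivrMr // ler_peMr ?mulr_ge0 //.
by rewrite ler1n.
Qed.

(** The difference of majorants factors as the exponential of the head times that of the tail minus
    1. The head costs [expR (2 * K)], linearising the tail costs another. *)
Lemma prod_dist_sqr (u : nat -> C) K m n : 0 <= K -> (m <= n)%N -> sqr_bound K u n ->
  nm (\prod_(k < n) (1 + u k) - \prod_(k < m) (1 + u k)) <= prod_tail K / m.+1%:R.
Proof.
move=> K0 mn ue; apply: le_trans (prod_dist mn ue) _.
move: mn => /subnK <-; rewrite addnC big_split_ord /= expRD -[X in _ - X]mulr1 -mulrBr.
have h1 : expR (\sum_(k < m) K / k.+1%:R ^+ 2) <= expR (2 * K).
  by rewrite ler_expR; have := sum_inv_sqr_le 0 m K0; rewrite divr1.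
have h2 := sum_inv_sqr_le m (n - m) K0.
apply: le_trans (_ : expR (2 * K) * (2 * K / m.+1%:R * expR (2 * K)) <= _).
  rewrite ler_pM ?expR_ge0 // ?subr_ge0.
    by rewrite -expR0 ler_expR sumr_ge0 // => i _; rewrite divr_ge0 ?exprn_ge0.
  by apply: le_trans (expR_tail_le m K0); rewrite lerD2r ler_expR.
rewrite /prod_tail; have -> : 4 * K = 2 * K + 2 * K by ring.
by rewrite expRD le_eqVlt; apply/orP; left; apply/eqP; ring.
Qed.

Lemma small_tail (T e : R) : 0 < e -> exists m, forall n, (m <= n)%N -> T / n.+1%:R <= e.
Proof.
move=> e0; exists (Num.truncn (`|T| / e)) => n mn.
rewrite ler_pdivrMr // (le_trans (ler_norm _)) // mulrC -ler_pdivrMr //.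
apply: le_trans (ltW (truncnS_gt _)) _; by rewrite ler_nat.
Qed.

Lemma prod_cvg (u : nat -> C) K : 0 <= K -> (forall n, sqr_bound K u n) ->
  exists l : C, (fun n => \prod_(k < n) (1 + u k)) @ \oo --> l.
Proof.
move=> K0 ue; apply: cauchyC_cvg => e e0.
have [N HN] := small_tail (prod_tail K) e0; exists N => m n Nm Nn.
wlog mn : m n Nm Nn / (m <= n)%N.
  by move=> H; case: (leqP m n) => [/H->//|/ltnW nm]; rewrite nmC H.
by rewrite nmC; apply: le_trans (prod_dist_sqr K0 mn (ue n)) (HN _ Nm).
Qed.

Lemma cvg_oo_sub (F : set_system nat) : \oo `<=` F -> forall N, \forall n \near F, (N <= n)%N.
Proof. by move=> sF N; apply: sF; exists N. Qed.

(* [F] is a general filter because the roots below only converge along an ultrafilter. *)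
Lemma prod_tannery (F : set_system nat) (FF : ProperFilter F) (v : nat -> nat -> C)
    (u : nat -> C) (l : C) K N0 : \oo `<=` F -> 0 <= K ->
  (forall n, (N0 <= n)%N -> sqr_bound K (v n) n.+1) ->
  (forall n, sqr_bound K u n) ->
  (forall k, (fun n => v n k) @ F --> u k) ->
  (fun n => \prod_(k < n) (1 + u k)) @ \oo --> l ->
  (fun n => \prod_(k < n.+1) (1 + v n k)) @ F --> l.
Proof.
move=> sF K0 ve ue vu ul; apply/cvg_nmP => e e0.
have e3 : 0 < e / 3 by rewrite divr_gt0.
(* The cutoff [m] makes the tails of both products at most [e / 3], uniformly in [n]; only finitely
   many factors are left to converge. *)
have [m Hm] := small_tail (prod_tail K) e3; have {Hm}Hm := Hm _ (leqnn m).
have hl : nm (l - \prod_(k < m) (1 + u k)) <= e / 3.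
  apply: (@nm_lim_le R _ \oo _ (fun n => \prod_(k < n) (1 + u k) - \prod_(k < m) (1 + u k))).
    exact: (cvgB ul (cvg_cst _)).
  exists m => // n /= mn; exact: le_trans (prod_dist_sqr K0 mn (ue n)) Hm.
have hm : (fun n => \prod_(k < m) (1 + v n k)) @ F --> \prod_(k < m) (1 + u k).
  elim: {hl Hm} m => [|m IH].
    under eq_fun do rewrite big_ord0; rewrite big_ord0; exact: cvg_cst.
  under eq_fun do rewrite big_ord_recr /=; rewrite big_ord_recr /=.
  exact: (cvgM IH (cvgD (cvg_cst _) (vu m))).
move/cvg_nmP: hm => /(_ _ e3) hm.
apply: filterS (filterI hm (filterI (cvg_oo_sub sF m) (cvg_oo_sub sF N0))) => n [h1 [h2 h3]].
have h4 := le_trans (prod_dist_sqr K0 (leqW h2) (ve _ h3)) Hm.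
have := nm_tri l (\prod_(k < n.+1) (1 + v n k)) (\prod_(k < m) (1 + u k)).
have := nm_tri (\prod_(k < m) (1 + u k)) (\prod_(k < n.+1) (1 + v n k)) (\prod_(k < m) (1 + v n k)).
rewrite nmC in h4; move: h1 => /= h1; lra.
Qed.

(** Beyond a suitable [m] the tail products stay within 1/2 of 1, so the products have modulus at
    least half that of the non-zero head [P]. *)
Lemma prod_lim_neq0 (u : nat -> C) (l : C) K : 0 <= K -> (forall n, sqr_bound K u n) ->
  (forall k, 1 + u k != 0) ->
  (fun n => \prod_(k < n) (1 + u k)) @ \oo --> l -> l != 0.
Proof.
move=> K0 ue u0 ul.
have [m Hm] := @small_tail (2 * K * expR (2 * K)) (1 / 2) ltac:(lra).
have {Hm}Hm := Hm _ (leqnn m).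
pose P := \prod_(k < m) (1 + u k).
have P0 : 0 < nm P by apply: nm_gt0; apply/eqP; apply/prodf_neq0.
have tail n : 1 / 2 <= nm (\prod_(k < n) (1 + u (m + k)%N)).
  have := @prod_dist (fun k => u (m + k)%N) (fun k => K / (m + k).+1%:R ^+ 2) 0 n (leq0n _)
    (fun k _ => ue _ _ (leqnn _)).
  rewrite !big_ord0 expR0 => /le_trans h.
  have {}h : nm (\prod_(k < n) (1 + u (m + k)%N) - 1) <= 1 / 2.
    apply: h; apply: le_trans (_ : expR (2 * K / m.+1%:R) - 1 <= _).
      by rewrite lerD2r ler_expR; apply: sum_inv_sqr_le.
    by apply: le_trans (expR_tail_le m K0) _; rewrite mulrAC.
  by have := nm_tri 1 0 (\prod_(k < n) (1 + u (m + k)%N)); rewrite !subr0 nm1 nmC; lra.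
apply/eqP => l0; move: ul; rewrite l0 => /cvg_nmP /(_ (nm P / 4)) [|N _ HN].
  by rewrite divr_gt0.
have := HN (m + N)%N (leq_addl _ _); rewrite /= sub0r nmN big_split_ord /= nmM.
have := tail N; rewrite -/P; nra.
Qed.

End InfiniteProducts.

(** * Differentiation of pointwise limits *)

Section JetLimits.
Variable R : realType.
Local Notation C := (Cplx R).
Implicit Types (r K e : R) (z w : C) (f g : C -> C).

(* The map [e |-> 1 + 3 * e] turns [jet_mul] into submultiplicativity. *)
Lemma jet_prod r K (u u1 : nat -> C -> C) : 0 <= K ->
  (forall k, jet r (K / k.+1%:R ^+ 2) (u k) (u1 k)) ->
  forall n, exists p1, jet r (expR (6 * K) + 1) (fun z => \prod_(k < n) (1 + u k z)) p1.
Proof.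
move=> K0 ju n; pose e k : R := K / k.+1%:R ^+ 2.
have e0 k : 0 <= e k by rewrite divr_ge0 ?exprn_ge0.
(* Following the product minus 1, through [p + u + p * u], keeps the factor 3 of [jet_mul] from
   accumulating at each step. *)
have H m : exists p1, jet r ((\prod_(k < m) (1 + 3 * e k) - 1) / 3)
     (fun z => \prod_(k < m) (1 + u k z) - 1) p1.
  elim: m => [|m [p1 IH]].
    exists (fun=> 0); rewrite big_ord0 subrr mul0r.
    have := jet_cst r (0 : C); rewrite nm0; apply: jet_ext => // z.
    by rewrite big_ord0 subrr.
  have h := jet_add (jet_add IH (ju m)) (jet_mul IH (ju m)).
  have E z : \prod_(k < m) (1 + u k z) - 1 + u m z + (\prod_(k < m) (1 + u k z) - 1) * u m z =
      \prod_(k < m.+1) (1 + u k z) - 1 by rewrite big_ord_recr /=; ring.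
  eexists; apply: (jet_le _ (jet_ext E (fun=> erefl _) h)).
  by rewrite big_ord_recr /= -/(e m) le_eqVlt; apply/orP; left; apply/eqP; field.
have [p1 h] := H n; exists (fun z => p1 z + 0).
have E z : \prod_(k < n) (1 + u k z) - 1 + 1 = \prod_(k < n) (1 + u k z) by rewrite subrK.
apply: (jet_le _ (jet_ext E (fun=> erefl _) (jet_add h (jet_cst r 1)))).
rewrite nm1 lerD2r.
have P1 : \prod_(k < n) (1 + 3 * e k) <= expR (6 * K).
    apply: le_trans (_ : expR (\sum_(k < n) 3 * e k) <= _).
      rewrite expR_sum; apply: ler_prod => i _; rewrite expR_ge1Dx andbT.
      by rewrite addr_ge0 // mulr_ge0.
    rewrite ler_expR -mulr_sumr; have := sum_inv_sqr_le 0 n K0; rewrite divr1.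
    under eq_bigr do rewrite add0n; rewrite -/(e _); lra.
have := expR_ge0 (6 * K); lra.
Qed.

(** Derivative at one point with quadratic remainder: the local trace of a jet, and enough to
    recover the derivative of the library. *)
Definition qdiff f z (d : C) := exists K r, [/\ 0 < r, 0 <= K &
  forall h, nm h <= r -> nm (f (z + h) - f z - h * d) <= K * nm h ^+ 2].

Lemma jet_qdiff r K f f1 z : nm z < r -> jet r K f f1 -> qdiff f z (f1 z).
Proof.
move=> zr [a _ _ d]; exists K, (r - nm z); split; first by rewrite subr_gt0.
  exact: le_trans (nm_ge0 _) (a _ (ltW zr)).
move=> h hr; have := d z (z + h) (ltW zr).
rewrite [z + h]addrC addrK => -> //; apply: le_trans (nmD _ _) _; lra.
Qed.

Lemma le_of_le_mul_small (a b s : R) : 0 < s -> 0 <= b ->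
  (forall t, 0 < t -> t <= s -> a * t <= b * t ^+ 2) -> a <= 0.
Proof.
move=> s0 b0 H; rewrite leNgt; apply/negP => a0.
(* For this [t] the product [b * t] is below [a], which contradicts the hypothesis divided by
   [t]. *)
have t0 : 0 < Num.min s (a / (2 * (b + 1))) by rewrite lt_min s0 divr_gt0 //; lra.
have := H _ t0; rewrite ge_min lexx => /(_ isT).
set t := Num.min _ _ in t0 *; have tb : t <= a / (2 * (b + 1)) by rewrite ge_min lexx orbT.
have {}tb : t * (2 * (b + 1)) <= a by rewrite -ler_pdivlMr //; lra.
rewrite expr2 mulrA; nra.
Qed.

(** Subtracting the two expansions along real steps [t] bounds [nm (d - d') * t] by a multiple of
    [t ^+ 2]. *)
Lemma qdiff_uniq f z d d' : qdiff f z d -> qdiff f z d' -> d = d'.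
Proof.
move=> [K [r [r0 K0 H]]] [K' [r' [r0' K0' H']]].
apply/eqP; rewrite -subr_eq0; apply/eqP; apply: nm_eq0; apply: le_anti; rewrite nm_ge0 andbT.
apply: (@le_of_le_mul_small _ (K + K') (Num.min r r')).
- by rewrite lt_min r0.
- by rewrite addr_ge0.
move=> t t0; rewrite le_min => /andP[tr tr'].
have nt : nm (RtoC t) = t by rewrite nmR gtr0_norm.
have := H (RtoC t); have := H' (RtoC t); rewrite nt => /(_ tr') h' /(_ tr) h.
have := nmB (f (z + RtoC t) - f z - RtoC t * d') (f (z + RtoC t) - f z - RtoC t * d).
have -> : f (z + RtoC t) - f z - RtoC t * d' - (f (z + RtoC t) - f z - RtoC t * d) =
  (d - d') * RtoC t by ring.
rewrite nmM nt; lra.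
Qed.

Lemma qdiff_is_derive f z d : qdiff f z d -> is_derive z 1 f d.
Proof.
move=> [K [r [r0 K0 H]]].
suff h : (fun h : C => h^-1 *: (f (h *: 1 + z) - f z)) @ (0 : C)^' --> d.
  by split; [apply/cvg_ex; exists d | apply: cvg_lim h].
apply/cvg_nmP => e e0.
have s0 : 0 < Num.min r (e / (K + 1)) by rewrite lt_min r0 divr_gt0 //; lra.
near=> h.
have h0 : h != 0 by near: h; exact: nbhs_dnbhs_neq.
have : nm h <= Num.min r (e / (K + 1)).
  near: h; apply: cvg_within.
  have /cvg_nmP/(_ _ s0) : (fun x : C => x) @ nbhs (0 : C) --> (0 : C) by exact: cvg_id.
  by apply: filterS => x; rewrite sub0r nmN.
rewrite le_min => /andP[hr he].
have {he}he : nm h * (K + 1) <= e by rewrite -ler_pdivlMr //; lra.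
have := H _ hr; rewrite [z + h]addrC => H1.
have -> : h *: 1 + z = h + z by rewrite [h *: _]mulr1.
have -> : d - h^-1 *: (f (h + z) - f z) = - h^-1 * (f (h + z) - f z - h * d).
  by rewrite -[_ *: _]/(h^-1 * _); field.
rewrite nmM nmN nmV ler_pdivrMl; last by apply: nm_gt0; apply/eqP.
apply: le_trans H1 _; have := nm_ge0 h; rewrite expr2; nra.
Unshelve. all: by end_near. Qed.

(** The remainder bound is independent of [n], so for each fixed [h] it passes to the limit. *)
Lemma qdiff_lim (F : set_system nat) (FF : ProperFilter F) r K (fn : nat -> C -> C)
    (dn : nat -> C) f z d :
  (\forall n \near F, exists2 f1, jet r K (fn n) f1 & f1 z = dn n) ->
  (forall w, (fun n => fn n w) @ F --> f w) ->
  dn @ F --> d -> nm z < r -> qdiff f z d.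
Proof.
move=> HJ Hf H1 zr; exists K, (r - nm z); split; first by rewrite subr_gt0.
  have [n [f1 [a _ _ _] _]] := filter_ex HJ.
  exact: le_trans (nm_ge0 _) (a _ (ltW zr)).
move=> h hr; apply: (@nm_lim_le R _ F _ (fun n => fn n (z + h) - fn n z - h * dn n)).
  exact: (cvgB (cvgB (Hf _) (Hf _)) (cvgM (cvg_cst _) H1)).
apply: filterS HJ => n [f1 [_ _ _ H] <-]; move: (H z (z + h) (ltW zr)).
rewrite [z + h]addrC addrK => -> //; apply: le_trans (nmD _ _) _; lra.
Qed.

(* Comparing difference quotients with a fixed small step shows that the derivatives
   form a Cauchy sequence. *)
Lemma jet_lim_ex r K (fn : nat -> C -> C) f z : (forall n, exists f1, jet r K (fn n) f1) ->
  (forall w, (fun n => fn n w) @ \oo --> f w) -> nm z < r ->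
  exists d, qdiff f z d.
Proof.
move=> /choice[f1 HJ] Hf zr.
suff [d Hd] : exists d : C, (fun n => f1 n z) @ \oo --> d.
  by exists d; apply: qdiff_lim Hd zr => //; apply: nearW => n; exists (f1 n).
have K0 : 0 <= K by have [a _ _ _] := HJ 0%N; exact: le_trans (nm_ge0 _) (a _ (ltW zr)).
apply: cauchyC_cvg => e e0.
(* In comparing two derivatives the two remainders [K * t ^+ 2] then cost at most [e * t / 2], and
   the four value errors [e * t / 8] cost the other half. *)
pose t := Num.min (r - nm z) (e / (4 * (K + 1))).
have t0 : 0 < t by rewrite lt_min subr_gt0 zr divr_gt0 //; lra.
have tr : t <= r - nm z by rewrite ge_min lexx.
have te : t * (4 * (K + 1)) <= e by rewrite -ler_pdivlMr ?ge_min ?lexx ?orbT //; lra.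
have nt : nm (RtoC t) = t by rewrite nmR gtr0_norm.
have d0 : 0 < e * t / 8 by rewrite divr_gt0 // mulr_gt0.
have /cvg_nmP/(_ _ d0)[N1 _ H1] := Hf z.
have /cvg_nmP/(_ _ d0)[N2 _ H2] := Hf (z + RtoC t).
exists (maxn N1 N2) => m n; rewrite !geq_max => /andP[m1 m2] /andP[n1 n2].
have A k : nm (fn k (z + RtoC t) - fn k z - RtoC t * f1 k z) <= K * t ^+ 2.
  have [_ _ _ /(_ z (z + RtoC t) (ltW zr))] := HJ k.
  rewrite [z + _]addrC addrK nt => -> //; apply: le_trans (nmD _ _) _; lra.
have B k : (N1 <= k)%N -> (N2 <= k)%N ->
    nm (RtoC t * f1 k z - (f (z + RtoC t) - f z)) <= K * t ^+ 2 + e * t / 4.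
  move=> k1 k2; have := H1 _ k1; have := H2 _ k2; have := A k => /= a1 a2 a3.
  have -> : RtoC t * f1 k z - (f (z + RtoC t) - f z) =
    - (fn k (z + RtoC t) - fn k z - RtoC t * f1 k z) -
     ((f (z + RtoC t) - fn k (z + RtoC t)) - (f z - fn k z)) by ring.
  apply: le_trans (nmB _ _) _; rewrite nmN.
  have := nmB (f (z + RtoC t) - fn k (z + RtoC t)) (f z - fn k z); lra.
have Bm := B _ m1 m2; have Bn := B _ n1 n2.
rewrite -(ler_pM2l t0) -{1}nt -nmM.
have -> : RtoC t * (f1 m z - f1 n z) = (RtoC t * f1 m z - (f (z + RtoC t) - f z)) -
   (RtoC t * f1 n z - (f (z + RtoC t) - f z)) by ring.
apply: le_trans (nmB _ _) _; rewrite expr2 in Bm Bn; nra.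
Qed.

End JetLimits.

(** * Harmonic numbers and the Euler constant *)

Section HarmonicNumbers.
Variable R : realType.

Definition harm n : R := \sum_(k < n) k.+1%:R^-1.
Definition gam n : R := harm n - ln n%:R.

Lemma harm0 : harm 0 = 0. Proof. by rewrite /harm big_ord0. Qed.

Lemma harmS n : harm n.+1 = harm n + n.+1%:R^-1.
Proof. by rewrite /harm big_ord_recr. Qed.

Lemma harmD k m : harm (k + m) = harm k + \sum_(i < m) (k + i).+1%:R^-1.
Proof. by rewrite /harm big_split_ord. Qed.

Lemma harm_le n : harm n <= n%:R.
Proof.
elim: n => [|n IH]; first by rewrite /harm big_ord0.
by rewrite harmS -[leRHS]natr1 lerD // invf_le1 ?ltr0n // ler1n.
Qed.

Lemma lnS_le n : ln n.+2%:R - ln n.+1%:R <= n.+1%:R^-1 :> R.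
Proof.
have x0 : 0 < n.+1%:R :> R by rewrite ltr0n.
rewrite -ln_div ?posrE ?ltr0n //.
have -> : n.+2%:R / n.+1%:R = 1 + n.+1%:R^-1 :> R.
  by rewrite -natr1 mulrDl divff ?gt_eqF // div1r.
by apply: le_ln1Dx; rewrite (lt_trans _ (_ : 0 < _)) ?invr_gt0.
Qed.

Lemma lnS_ge n : n.+2%:R^-1 <= ln n.+2%:R - ln n.+1%:R :> R.
Proof.
have x0 : 0 < n.+2%:R :> R by rewrite ltr0n.
rewrite -lerN2 opprB -ln_div ?posrE ?ltr0n //.
have -> : n.+1%:R / n.+2%:R = 1 + - n.+2%:R^-1 :> R.
  by rewrite -[n.+2%:R]natr1 in x0 *; field; rewrite gt_eqF.
by apply: le_ln1Dx; rewrite ltrN2 invf_lt1 // ltr1n.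
Qed.

Lemma ln_le_harm n : ln n.+1%:R <= harm n.
Proof.
elim: n => [|n IH]; first by rewrite ln1 /harm big_ord0.
apply: le_trans (_ : ln n.+1%:R + n.+1%:R^-1 <= _); last by rewrite harmS lerD2r.
by rewrite -lerBlDl lnS_le.
Qed.

Lemma gam_ge0 n : 0 <= gam n.+1.
Proof.
by rewrite subr_ge0; apply: le_trans (ln_le_harm n) _; rewrite harmS lerDl.
Qed.

Lemma gamS_le n : gam n.+2 <= gam n.+1.
Proof. by rewrite /gam harmS -addrA lerD2l lerBlDr addrC lnS_ge. Qed.

Lemma gam_le1 n : gam n.+1 <= 1.
Proof.
elim: n => [|n IH]; last exact: le_trans (gamS_le n) IH.
by rewrite /gam /harm big_ord1 ln1 subr0 invr1.
Qed.

Lemma ln_lt_harm n : ln n.+1%:R < harm n.+1.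
Proof. by apply: le_lt_trans (ln_le_harm n) _; rewrite harmS ltrDl invr_gt0 ltr0n. Qed.

Lemma gam_cvg : gam @ \oo --> euler_gamma R.
Proof.
have -> : euler_gamma R = limn gam.
  rewrite /euler_gamma; congr (limn _); apply/funext => n.
  by rewrite /gam /harm big_add1 /= big_mkord.
suff [l Hl] : exists l : R, gam @ \oo --> l by rewrite (cvg_lim _ Hl) //; exact: Rhausdorff.
(* The shift is needed for monotonicity: [gam 0 = 0] lies below [gam 1 = 1]. *)
exists (limn (fun n => gam n.+1)); rewrite -cvg_shiftS; apply: nonincreasing_is_cvgn.
  by apply/nonincreasing_seqP => n; apply: gamS_le.
by exists 0 => _ [n _ <-]; apply: gam_ge0.
Qed.

End HarmonicNumbers.

(** * Real roots of the numerator of G_n' *)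

Section RealRoots.
Variable R : realType.
Local Notation harm := (@harm R).

Definition risfac n : {poly R} := \prod_(j < n.+1) ('X + j%:R%:P).
(* With [G_n(z) = risfac n z / (n! n^z)], the derivative of [G_n] is
   [critp n z / (n! n^z)]. *)
Definition critp n : {poly R} := (risfac n)^`() - (ln n%:R)%:P * risfac n.
(** The logarithmic derivative of [G_n]. *)
Definition recsum n (x : R) : R := \sum_(j < n.+1) (x + j%:R)^-1 - ln n%:R.

Lemma critpE n x : (forall j, x + j%:R != 0) ->
  (critp n).[x] = (\prod_(j < n.+1) (x + j%:R)) * recsum n x.
Proof.
move=> x0; rewrite /critp /recsum /risfac !hornerE.
set E := (X in X + _ = _); set P := \prod_(j < n.+1) (x + j%:R).
have PE m : (\prod_(j < m) ('X + j%:R%:P)).[x] = \prod_(j < m) (x + j%:R).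
  by rewrite horner_prod; apply: eq_bigr => j _; rewrite !hornerE.
have -> : E = P * \sum_(j < n.+1) (x + j%:R)^-1.
  rewrite /E /P; elim: n.+1 => [|m IH]; first by rewrite !big_ord0 derivC !hornerE.
  rewrite !big_ord_recr /= derivM !hornerE IH PE !poly.derivE ?hornerE.
  by field; apply: x0.
by rewrite PE -/P; ring.
Qed.

(* For [n >= max(k, 4)] the rational function [recsum n] changes sign on
   [[lo k, hi k]], and these intervals are disjoint and avoid the poles. *)
Definition lo k : R := if k is k'.+1 then - k'.+1%:R + (3 * k'.+1%:R + 2)^-1 else 1.
Definition hi k : R := if k is k'.+1 then - k'.+1%:R + 3 / 4 else 4.

Lemma lo_gt k : - k%:R < lo k.
Proof.
case: k => [|k] /=; first by rewrite oppr0.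
by rewrite ltrDl invr_gt0 addr_gt0 // mulr_gt0 // ltr0n.
Qed.

Lemma lo_le_hi k : lo k <= hi k.
Proof.
case: k => [|k] /=; first by lra.
have h : 1 <= k.+1%:R :> R by rewrite ler1n.
rewrite lerD2l; apply: le_trans (_ : 5^-1 <= _); last by lra.
by rewrite lef_pV2 ?posrE; lra.
Qed.

Lemma hi_lt_lo i j : (i < j)%N -> hi j < lo i.
Proof.
case: j => // j ij; apply: le_lt_trans (lo_gt i) => /=.
have : i%:R <= j%:R :> R by rewrite ler_nat.
by rewrite -natr1; lra.
Qed.

Lemma recsum_lo0 n : (0 < n)%N -> 0 <= recsum n 1.
Proof.
case: n => // n _; rewrite /recsum subr_ge0.
have -> : \sum_(j < n.+2) (1 + j%:R)^-1 = harm n.+2.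
  by apply: eq_bigr => j _; rewrite nat1r.
by apply: le_trans (ltW (ln_lt_harm R n)) _; rewrite [leRHS]harmS lerDl.
Qed.

(** The sum equals [harm (n + 4) - harm 3]. The four terms past [harm n] are at most 1/5 each as
    [n >= 4], and [4 / 5 + 1 < 11 / 6 = harm 3], where 1 bounds [gam n]. *)
Lemma recsum_hi0 n : (4 <= n)%N -> recsum n 4 <= 0.
Proof.
move=> n4; have n5 : 5 <= n.+1%:R :> R by rewrite ler_nat.
have -> : recsum n 4 = harm (3 + n.+1) - harm 3 - ln n%:R.
  rewrite harmD /recsum; congr (_ - _); rewrite addrAC subrr add0r.
  by apply: eq_bigr => j _; rewrite -natrD.
have -> : (3 + n.+1 = n + 4)%N by rewrite addnC addSnnS.
have h3 : harm 3 = 11 / 6 by rewrite !harmS harm0; lra.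
have h4 : \sum_(i < 4) (n + i).+1%:R^-1 <= 4 / 5 :> R.
  apply: le_trans (_ : \sum_(i < 4) (5^-1 : R) <= _); last by rewrite sumr_const card_ord; lra.
  apply: ler_sum => i _; rewrite lef_pV2 ?posrE ?ltr0n // ler_nat ltnS (leq_trans n4) ?leq_addr //.
rewrite harmD h3; case: n n4 h4 {n5} => // n _ h4.
have := gam_le1 R n; rewrite /gam; lra.
Qed.

Lemma recsum_split k m x : recsum (k + m) x =
  \sum_(j < k) (x + j%:R)^-1 + (x + k%:R)^-1 + \sum_(i < m) (x + (k + i).+1%:R)^-1
  - ln (k + m)%:R.
Proof.
rewrite /recsum -addnS big_split_ord /= big_ord_recl /= addn0 addrA.
by congr (_ + _ + _ - _); apply: eq_bigr => i _; rewrite /bump /= addnS.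
Qed.

(** With [K = k + 1], the terms before the pole at [- K] give at least [- 2 * K], the pole term is
    [3 * K + 2], and the later ones give at least [harm n - K], where [harm n >= ln n]. The offset
    in [lo] is chosen for this balance. *)
Lemma recsum_lo k n : (k < n)%N -> 0 <= recsum n (lo k.+1).
Proof.
move=> kn; have [m nE] : exists m, n = (k.+1 + m)%N by exists (n - k.+1)%N; rewrite subnKC.
rewrite {1}nE recsum_split -nE /=.
set K : R := k.+1%:R; set d := (3 * K + 2)^-1.
have K1 : 1 <= K by rewrite ler1n.
have d0 : 0 < d by rewrite invr_gt0; lra.
have d5 : d <= 5^-1 by rewrite lef_pV2 ?posrE; lra.
have S1 : - (2 * K) <= \sum_(j < k.+1) (- K + d + j%:R)^-1.
  rewrite -[- _]mulNr mulr_natr -[X in _ *+ X]card_ord -sumr_const; apply: ler_sum => j _.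
  have : j%:R + 1 <= K by rewrite natr1 ler_nat.
  move=> jK; rewrite -[leRHS]opprK -invrN lerN2 -[leRHS]invrK lef_pV2 ?posrE; lra.
have S2 : (- K + d + k.+1%:R)^-1 = 3 * K + 2.
  by rewrite -/K addrAC addNr add0r invrK.
have S3 : harm n - harm k.+1 <= \sum_(i < m) (- K + d + (k.+1 + i).+1%:R)^-1.
  rewrite nE harmD [_ + \sum_(_ < _) _]addrC addrK; apply: ler_sum => i _.
  have -> : (k.+1 + i).+1%:R = K + i.+1%:R :> R by rewrite -addnS natrD.
  have i1 : 0 < i.+1%:R :> R by rewrite ltr0n.
  rewrite lef_pV2 ?posrE; lra.
have H1 := harm_le R k.+1; rewrite -/K in H1.
have H2 : ln n%:R <= harm n by case: n kn {nE S3} => // n _; apply/ltW/ln_lt_harm.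
rewrite S2; lra.
Qed.

(** The terms [j = k] and [j = k + 1] are -4 and 4/3, earlier ones are negative, and later ones sum
    to at most [harm n <= 1 + ln n]. *)
Lemma recsum_hi k n : (k < n)%N -> recsum n (hi k.+1) <= 0.
Proof.
move=> kn; have [m nE] : exists m, n = (k.+1 + m)%N by exists (n - k.+1)%N; rewrite subnKC.
rewrite {1}nE recsum_split -nE /= big_ord_recr /=.
set K : R := k.+1%:R.
have K1 : 1 <= K by rewrite ler1n.
have S1 : \sum_(j < k) (- K + 3 / 4 + j%:R)^-1 <= 0.
  apply: sumr_le0 => j _; rewrite invr_le0.
  have : j%:R + 1 <= K by rewrite natr1 ler_nat ltnW // ltnS.
  lra.
have S0 : (- K + 3 / 4 + k%:R)^-1 = - 4.
  rewrite /K -natr1; have -> : - (k%:R + 1) + 3 / 4 + k%:R = - 4^-1 :> R by field.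
  by rewrite invrN invrK.
have S2 : (- K + 3 / 4 + k.+1%:R)^-1 = 4 / 3.
  by rewrite -/K addrAC addNr add0r invf_div.
have S3 : \sum_(i < m) (- K + 3 / 4 + (k.+1 + i).+1%:R)^-1 <= harm n.
  apply: le_trans (_ : harm m <= _).
    apply: ler_sum => i _.
    have -> : (k.+1 + i).+1%:R = K + i.+1%:R :> R by rewrite -addnS natrD.
    have i1 : 0 < i.+1%:R :> R by rewrite ltr0n.
    rewrite lef_pV2 ?posrE; lra.
  by rewrite nE addnC harmD lerDl sumr_ge0.
have H2 : harm n <= 1 + ln n%:R.
  by case: n kn {nE S3} => // n _; have := gam_le1 R n; rewrite /gam; lra.
rewrite S2 S0; lra.
Qed.

(** No pole separates [lo k] from [hi k], so paired factors agree in sign and [critp] inherits the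
    sign change of [recsum]. *)
Lemma prod_lo_hi_ge0 k n : 0 <= \prod_(j < n) (lo k + j%:R) * \prod_(j < n) (hi k + j%:R).
Proof.
rewrite -big_split /=; apply: prodr_ge0 => j _.
case: k => [|k]; first by rewrite /= mulr_ge0 ?addr_ge0.
have := lo_gt k.+1; have := lo_le_hi k.+1.
have hE : hi k.+1 = - k.+1%:R + 3 / 4 by [].
case: (leqP k.+1 j) => [kj|jk] h1 h2.
  have : k.+1%:R <= j%:R :> R by rewrite ler_nat.
  by move=> ?; rewrite mulr_ge0; lra.
have : j%:R + 1 <= k.+1%:R :> R by rewrite natr1 ler_nat.
by move=> ?; rewrite mulr_le0; lra.
Qed.

Lemma lo_neq0 k j : lo k + j%:R != 0.
Proof.
case: k => [|k]; first by rewrite /= gt_eqF // ltr_pwDl.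
have := lo_gt k.+1; have := lo_le_hi k.+1.
have hE : hi k.+1 = - k.+1%:R + 3 / 4 by [].
case: (leqP k.+1 j) => [kj|jk] h1 h2.
  have : k.+1%:R <= j%:R :> R by rewrite ler_nat.
  lra.
have : j%:R + 1 <= k.+1%:R :> R by rewrite natr1 ler_nat.
lra.
Qed.

Lemma hi_neq0 k j : hi k + j%:R != 0.
Proof.
case: k => [|k]; first by rewrite /= gt_eqF // ltr_pwDl.
have hE : hi k.+1 = - k.+1%:R + 3 / 4 by [].
case: (leqP k.+1 j) => [kj|jk].
  have : k.+1%:R <= j%:R :> R by rewrite ler_nat.
  lra.
have : j%:R + 1 <= k.+1%:R :> R by rewrite natr1 ler_nat.
lra.
Qed.

Lemma critp_root n k : (4 <= n)%N -> (k <= n)%N ->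
  exists x, lo k <= x <= hi k /\ root (critp n) x.
Proof.
move=> n4 kn.
have [||x] := @polyrcf.poly_ivt R (critp n) (lo k) (hi k).
- exact: lo_le_hi.
- rewrite !critpE; [|exact: hi_neq0|exact: lo_neq0].
  rewrite mulrACA mulr_ge0_le0 ?prod_lo_hi_ge0 //.
  case: k kn => [|k] kn.
    by rewrite mulr_ge0_le0 ?recsum_hi0 // recsum_lo0 // (leq_trans _ n4).
  by rewrite mulr_ge0_le0 ?recsum_hi ?recsum_lo.
by rewrite in_itv /= => h1 h2; exists x.
Qed.

(** Entries with [n < 4] or [k > n] are arbitrary. *)
Definition crit_enum (al : nat -> nat -> R) := forall n k, (4 <= n)%N -> (k <= n)%N ->
  lo k <= al n k <= hi k /\ root (critp n) (al n k).

Lemma crit_enum_ex : exists al, crit_enum al.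
Proof.
have H n k : exists x, (4 <= n)%N -> (k <= n)%N -> lo k <= x <= hi k /\ root (critp n) x.
  case: (boolP ((4 <= n)%N && (k <= n)%N)) => [/andP[a b]|h].
    by have [x hx] := critp_root a b; exists x.
  by exists 0 => a b; rewrite a b in h.
have H2 n := choice (H n); have [al Hal] := choice (fun n => ex_intro _ _ (projT2 (H2 n))).
by exists al => n k; apply: Hal.
Qed.

(** Linear growth in [k], uniform in [n], is what makes the products converge. The constant 1/8 is
    tight at index 1, where [hi] is -1/4. *)
Lemma lo_hi_norm k x : lo k <= x <= hi k -> k.+1%:R / 8 <= `|x|.
Proof.
case: k => [/=|k] /andP[h1 h2]; first by rewrite ger0_norm; lra.
have hE : hi k.+1 = - k.+1%:R + 3 / 4 by [].
have k1 : 1 <= k.+1%:R :> R by rewrite ler1n.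
rewrite -[k.+2%:R]natr1 ler0_norm; lra.
Qed.

Lemma size_risfac n : size (risfac n) = n.+2.
Proof.
rewrite /risfac (eq_bigr (fun j : 'I_n.+1 => 'X - (- j%:R : R)%:P)); last first.
  by move=> j _; rewrite polyCN opprK.
by rewrite size_prod_XsubC /index_enum -enumT size_enum_ord.
Qed.

(** The leading term comes from [ln n * risfac n], and [ln n] is non-zero for [n > 1]. *)
Lemma size_critp n : (1 < n)%N -> size (critp n) = n.+2.
Proof.
move=> n1; have l0 : ln n%:R != 0 :> R.
  by rewrite gt_eqF // ln_gt0 // ltr1n.
have h : size ((ln n%:R)%:P * risfac n) = n.+2 by rewrite size_Cmul // size_risfac.
rewrite /critp addrC size_polyDl size_polyN h //.
by rewrite -(size_risfac n) lt_size_deriv // -size_poly_eq0 size_risfac.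
Qed.

Definition linprod (a : nat -> R) n : {poly R} := \prod_(k < n) (1 + a k *: 'X).

Lemma linprod0 a n : (linprod a n).[0] = 1.
Proof.
by rewrite /linprod horner_prod big1 // => k _; rewrite !hornerE ?mulr0 ?addr0.
Qed.

Lemma linprod_deriv0 a n : (linprod a n)^`().[0] = \sum_(k < n) a k.
Proof.
elim: n => [|n IH]; first by rewrite /linprod !big_ord0 derivC horner0.
rewrite big_ord_recr -IH /=.
have -> : linprod a n.+1 = linprod a n * (1 + a n *: 'X) by rewrite /linprod big_ord_recr.
rewrite derivM !poly.derivE hornerD !hornerM linprod0 !hornerE ?mulr0 ?addr0 ?add0r.
by rewrite /= addr0.
Qed.

Lemma risfac_linprod n : risfac n = n`!%:R *: ('X * linprod (fun k => k.+1%:R^-1) n).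
Proof.
rewrite /risfac big_ord_recl /= addr0 scalerAr; congr (_ * _).
elim: n => [|n IH]; first by rewrite /linprod !big_ord0 fact0 scale1r.
rewrite big_ord_recr /= IH /linprod big_ord_recr /= factS natrM mulrC.
rewrite -scalerAr; rewrite [n.+1%:R * _]mulrC -[(_ * _) *: _]scalerA; congr (_ *: _).
rewrite scalerAr mulrC; congr (_ * _).
rewrite scalerDr scalerA divff ?pnatr_eq0 // scale1r addrC /bump /= add1n.
by rewrite -[n.+1%:R *: 1]mul_polyC mulr1.
Qed.

(** The intervals are disjoint, so the [n + 1] roots are distinct and exhaust the degree. The
    constant is the value at 0, that is the derivative of [risfac n] there, [n!]. *)
Lemma critp_linprod al n : crit_enum al -> (4 <= n)%N ->
  critp n = n`!%:R *: linprod (fun k => - (al n k)^-1) n.+1.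
Proof.
move=> Hal n4; have [c Hc] : exists c, critp n = c *: linprod (fun k => - (al n k)^-1) n.+1.
  have H : critp n = lead_coef (critp n) *:
      \prod_(z <- [seq al n k | k <- iota 0 n.+1]) ('X - z%:P).
    apply: all_roots_prod_XsubC.
    - by rewrite size_critp ?size_map ?size_iota // (leq_trans _ n4).
    - apply/allP => z /mapP[k]; rewrite mem_iota /= add0n ltnS => kn ->.
      by have [] := Hal n k n4 kn.
    - rewrite uniq_rootsE map_inj_in_uniq ?iota_uniq // => i j.
      rewrite !mem_iota /= !add0n !ltnS => ni nj.
      have [/andP[a1 a2] _] := Hal n i n4 ni; have [/andP[b1 b2] _] := Hal n j n4 nj.
      move=> ij; case: (ltngtP i j) => // /hi_lt_lo h; exfalso; lra.
  exists (lead_coef (critp n) * \prod_(k < n.+1) (- al n k)); rewrite {1}H.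
  rewrite -scalerA; congr (_ *: _); rewrite big_map /linprod.
  rewrite -(big_mkord xpredT (fun k => - al n k)).
  rewrite -(big_mkord xpredT (fun k => 1 + - (al n k)^-1 *: 'X)) /index_iota subn0.
  rewrite -mul_polyC rmorph_prod -big_split /=; apply: eq_big_seq => k.
  rewrite -[0%N :: _]/(iota 0 n.+1) mem_iota /= add0n ltnS => kn.
  have [/lo_hi_norm h _] := Hal n k n4 kn.
  have a0 : al n k != 0.
    by rewrite -normr_gt0; apply: lt_le_trans h; rewrite divr_gt0 // ltr0n.
  rewrite mulrDr mulr1 mul_polyC scalerA mulrN mulNr opprK divff // scale1r addrC.
  by rewrite polyCN.
rewrite Hc; congr (_ *: _); have : (critp n).[0] = c by rewrite Hc hornerZ linprod0 mulr1.
move=> <-; rewrite /critp risfac_linprod derivZ derivM derivX mul1r !hornerE.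
by rewrite linprod0 /= !(mul0r, mulr0, addr0, subr0, mulr1).
Qed.

(** Comparison of coefficients of degree 1: differentiating ['X * linprod] doubles the harmonic
    number, the origin of the 2 in the exponent [2 * gamma * z]. *)
Lemma crit_sum_inv al n : crit_enum al -> (4 <= n)%N ->
  \sum_(k < n.+1) (al n k)^-1 = ln n%:R - 2 * harm n.
Proof.
move=> Hal n4; have := congr1 (fun p => p^`().[0]) (critp_linprod Hal n4) => /=.
rewrite derivZ hornerZ linprod_deriv0 sumrN.
rewrite /critp risfac_linprod !poly.derivE !hornerE.
rewrite linprod_deriv0 linprod0 -/(harm n) /= !(addr0, mulr1).
have f0 : n`!%:R != 0 :> R by rewrite pnatr_eq0 -lt0n fact_gt0.
by move=> h; apply: (mulfI f0); lra.
Qed.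

End RealRoots.

(** * The Weierstrass product for 1/Gamma *)

Section EulerProduct.
Variable R : realType.
Local Notation C := (Cplx R).
Implicit Types (r K : R) (z w : C).

Lemma derivable_cts (f : C -> C) z : derivable f z 1 -> f w @[w --> z] --> f z.
Proof. by move=> df; apply: differentiable_continuous; apply/derivable1_diffP. Qed.

Lemma qdiff_cts (f : C -> C) z d : qdiff f z d -> f w @[w --> z] --> f z.
Proof. by move=> /qdiff_is_derive[df _]; apply: derivable_cts. Qed.

Lemma qdiff_cexp z : qdiff (@cexp R) z (cexp z).
Proof.
have [K _ HK] := jet_cexp (nm z + 1).
by apply: jet_qdiff HK; rewrite ltrDl.
Qed.

Lemma qdiff_Efac z : qdiff (@Efac R) z (- z * cexp z).
Proof.
have [|K [_ _ HK]] := @Efac_jet R (nm z + 1); first by rewrite addr_ge0 ?nm_ge0.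
have E w : Efac w - 1 + 1 = Efac w by rewrite subrK.
have := jet_ext E (fun w => addr0 _) (jet_add HK (jet_cst _ 1)).
by apply: jet_qdiff; rewrite ltrDl.
Qed.

Lemma cexp_cvg T (F : set_system T) (FF : Filter F) (f : T -> C) (l : C) :
  f @ F --> l -> (fun t => cexp (f t)) @ F --> cexp l.
Proof. by move=> fl; apply: cvg_comp fl (qdiff_cts (qdiff_cexp l)). Qed.

Lemma Efac_cvg T (F : set_system T) (FF : Filter F) (f : T -> C) (l : C) :
  f @ F --> l -> (fun t => Efac (f t)) @ F --> Efac l.
Proof. by move=> fl; apply: cvg_comp fl (qdiff_cts (qdiff_Efac l)). Qed.

Lemma prod_Efac (a : nat -> R) n z : \prod_(k < n) Efac (z / RtoC (a k)) =
  \prod_(k < n) (1 - z / RtoC (a k)) * cexp (z * RtoC (\sum_(k < n) (a k)^-1)).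
Proof.
elim: n => [|n IH]; first by rewrite !big_ord0 RtoC0 mulr0 cexp0 mulr1.
rewrite !big_ord_recr /= IH RtoCD RtoCV [z * (_ + _)]mulrDr cexpD /Efac; ring.
Qed.

(* The reciprocal of the n-th Euler approximant of Gamma. *)
Definition Ginv n z : C :=
  \prod_(k < n.+1) (z + k%:R) / (n`!%:R * cexp (z * RtoC (ln n%:R))).

Lemma GammaE z : Gamma z = limn (fun n => (Ginv n z)^-1).
Proof. by rewrite /Gamma; congr (limn _); apply/funext => n; rewrite invf_div. Qed.

(** The zeros of 1/Gamma other than 0, which enters as the separate factor [z]. *)
Definition neg_nat k : R := - k.+1%:R.

(** The convergence factors multiply to the exponential of [- harm n * z]; compensating it against
    the power of [n] leaves the exponent [gam n * z]. *)
Lemma Ginv_Efac n z : Ginv n z =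
  z * cexp (RtoC (gam R n) * z) * \prod_(k < n) (1 + (Efac (z / RtoC (neg_nat k)) - 1)).
Proof.
under eq_bigr do rewrite addrC subrK.
rewrite prod_Efac /Ginv big_ord_recl /= addr0.
have -> : \sum_(k < n) (neg_nat k)^-1 = - harm R n.
  by rewrite /harm -sumrN; apply: eq_bigr => k _; rewrite invrN.
have -> : \prod_(i < n) (z + (bump 0 i)%:R) = n`!%:R * \prod_(k < n) (1 - z / RtoC (neg_nat k)).
  elim: n => [|n IH]; first by rewrite !big_ord0 mulr1.
  rewrite !big_ord_recr /= IH factS natrM /neg_nat RtoCN RtoCn /bump /= add1n.
  have : n.+1%:R != 0 :> C by rewrite pnatr_eq0.
  by move: n.+1%:R => x x0; field.
have f0 : n`!%:R != 0 :> C by rewrite pnatr_eq0 -lt0n fact_gt0.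
have e0 := cexp_neq0 (z * RtoC (ln n%:R)).
have -> : cexp (RtoC (gam R n) * z) = cexp (z * RtoC (harm R n)) / cexp (z * RtoC (ln n%:R)).
  by rewrite -cexpN -cexpD /gam RtoCB; congr cexp; ring.
rewrite RtoCN mulrN cexpN.
by have e1 := cexp_neq0 (z * RtoC (harm R n)); field; rewrite f0 e0 e1.
Qed.

Lemma Efac_sqr_bound r : 0 <= r -> exists2 K, 0 <= K &
  forall z (a : nat -> R) n, nm z <= r ->
    (forall k, (k < n)%N -> k.+1%:R / 8 <= `|a k|) ->
  sqr_bound K (fun k => Efac (z / RtoC (a k)) - 1) n.
Proof.
move=> r0; have [K K0 HK] := Efac_scaled_jet r0; exists K => // z a n zr ha k kn.
by have [/(_ z zr)] := HK (a k) k (ha k kn).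
Qed.

(* The factors are kept as [1 + (E - 1)], the form required by the product lemmas. *)
Definition canprod (a : nat -> R) n z : C := \prod_(k < n) (1 + (Efac (z / RtoC (a k)) - 1)).
Definition canlim (a : nat -> R) z : C := limn (fun n => canprod a n z).

Lemma canprod_jet (a : nat -> R) r : 0 <= r -> (forall k, k.+1%:R / 8 <= `|a k|) ->
  exists K, forall n, exists f1, jet r K (canprod a n) f1.
Proof.
move=> r0 ha; have [K K0 HK] := Efac_scaled_jet r0; exists (expR (6 * K) + 1) => n.
exact: (jet_prod K0 (fun k => HK (a k) k (ha k)) n).
Qed.

Lemma canprod_cvg (a : nat -> R) z : (forall k, k.+1%:R / 8 <= `|a k|) ->
  (fun n => canprod a n z) @ \oo --> canlim a z.
Proof.
move=> ha; have [K K0 HK] := Efac_sqr_bound (nm_ge0 z).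
have [l Hl] := prod_cvg K0 (fun n => HK z a n (lexx _) (fun k _ => ha k)).
by rewrite /canlim (cvg_lim _ Hl) //; exact: norm_hausdorff.
Qed.

Lemma canlim_qdiff (a : nat -> R) z : (forall k, k.+1%:R / 8 <= `|a k|) ->
  exists d, qdiff (canlim a) z d.
Proof.
move=> ha; have [|K HK] := @canprod_jet a (nm z + 1) _ ha.
  by rewrite addr_ge0 ?nm_ge0.
by apply: (jet_lim_ex HK (fun w => @canprod_cvg a w ha)); rewrite ltrDl.
Qed.

Lemma Efac_eq0 z : (Efac z == 0) = (z == 1).
Proof. by rewrite mulf_eq0 (negPf (cexp_neq0 z)) orbF subr_eq0 eq_sym. Qed.

(** Off the [a k] no factor vanishes, hence neither does the limit; at [a k] every partial product
    past [k] is 0. *)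
Lemma canlim_eq0 (a : nat -> R) z : (forall k, k.+1%:R / 8 <= `|a k|) ->
  canlim a z = 0 <-> exists k, z = RtoC (a k).
Proof.
move=> ha.
have an0 k : RtoC (a k) != 0.
  apply/eqP => h; have := ha k; have -> : a k = 0 by apply: (@RtoC_inj R).
  by rewrite normr0 leNgt divr_gt0 // ltr0n.
split => [l0|[k ->]].
  apply: contrapT => H; have [K K0 HK] := Efac_sqr_bound (nm_ge0 z).
  have := prod_lim_neq0 K0 (fun n => HK z a n (lexx _) (fun k _ => ha k)) _ (@canprod_cvg a z ha).
  rewrite l0 eqxx => h; suff : false by []; apply: h => k; rewrite addrC subrK Efac_eq0.
  apply/eqP => h; apply: H; exists k.
  by rewrite -[LHS](divfK (an0 k)) h mul1r.
have H : (fun n => canprod a n (RtoC (a k))) @ \oo --> (0 : C).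
  apply/cvg_nmP => e e0; exists k.+1 => // n /= kn.
  rewrite /canprod (bigD1 (Ordinal kn)) //= divff //.
  by rewrite {1}/Efac subrr mul0r !sub0r subrr mul0r oppr0 nm0 ltW.
by rewrite -(cvg_lim (@norm_hausdorff _ _) H).
Qed.

Lemma neg_nat_ge k : k.+1%:R / 8 <= `|neg_nat k|.
Proof. by rewrite normrN ger0_norm // ler_pdivrMr // ler_peMr // ler1n. Qed.

(** The entire function 1/Gamma, meaningful also at the poles of [Gamma]. *)
Definition Glim z : C := z * cexp (RtoC (euler_gamma R) * z) * canlim neg_nat z.

Lemma Ginv_cvg z : (fun n => Ginv n z) @ \oo --> Glim z.
Proof.
under eq_fun do rewrite Ginv_Efac.
apply: (cvgM (cvgM (cvg_cst z) _)); last exact: (@canprod_cvg neg_nat z neg_nat_ge).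
by apply: cexp_cvg; apply: (cvgM (RtoC_cvg _ (@gam_cvg R)) (cvg_cst z)).
Qed.

Lemma Glim_eq0 z : Glim z = 0 <-> nonpos_int z.
Proof.
split => [/eqP|].
  rewrite /Glim mulf_eq0 [X in X || _]mulf_eq0 (negPf (cexp_neq0 _)) orbF => /orP[/eqP ->|/eqP].
    by exists 0%N; rewrite oppr0.
  move=> /(canlim_eq0 _ neg_nat_ge)[k ->]; exists k.+1.
  by rewrite /neg_nat RtoCN RtoCn.
move=> [[|k] ->]; first by rewrite oppr0 /Glim !mul0r.
suff -> : Glim (- k.+1%:R) = 0 by [].
rewrite /Glim; have -> : canlim neg_nat (- k.+1%:R) = 0; last by rewrite mulr0.
by apply/(canlim_eq0 _ neg_nat_ge); exists k; rewrite /neg_nat RtoCN RtoCn.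
Qed.

Lemma Gamma_Glim z : ~ nonpos_int z -> Gamma z = (Glim z)^-1.
Proof.
move=> nz; rewrite GammaE; apply: cvg_lim; first exact: norm_hausdorff.
apply: cvgV; last exact: Ginv_cvg.
by apply/eqP => /Glim_eq0.
Qed.

(** Uniformity in [n] rests on [gam n] lying in [0, 1] and on the linear growth of [neg_nat]. *)
Lemma Ginv_jet r : 0 <= r ->
  exists K, forall n, (0 < n)%N -> exists f1, jet r K (Ginv n) f1.
Proof.
move=> r0; have [K HK] := canprod_jet r0 neg_nat_ge; have [K' K0' HK'] := jet_cexp r.
exists (3 * (3 * (r + 1) * (K' * (1 + 1 + 1 ^+ 2))) * K) => n n0.
have [f1 Hf1] := HK n.
have g1 : nm (RtoC (gam R n)) <= 1.
  by case: n n0 {f1 Hf1} => // n _; rewrite nmR ger0_norm ?gam_ge0 ?gam_le1.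
have h := jet_mul (jet_mul (jet_id r0) (jet_scale K0' g1 _ HK')) Hf1.
eexists; apply: (jet_ext _ _ (h _)) => [z||]; last by rewrite mul1r.
  by rewrite Ginv_Efac.
by [].
Qed.

End EulerProduct.

(** * The derivative of 1/Gamma as a product over limits of roots *)

Section Derivative.
Variable R : realType.
Local Notation C := (Cplx R).
Implicit Types (r K : R) (z w : C).

Lemma poly_jet (p : {poly C}) r : 0 <= r ->
  exists K, jet r K (fun z => p.[z]) (fun z => p^`().[z]).
Proof.
move=> r0; elim/poly_ind: p => [|p c [K IH]].
  exists (nm (0 : C)); apply: (jet_ext _ _ (jet_cst r 0)) => z; by rewrite ?linear0 horner0.
eexists; apply: (jet_ext _ _ (jet_add (jet_mul IH (jet_id r0)) (jet_cst r c))) => z.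
  by rewrite hornerMXaddC.
by rewrite derivD derivM derivX derivC !addr0 !mulr1 hornerD hornerMX.
Qed.

Definition rcpoly (p : {poly R}) : {poly C} := map_poly (real_complex R) p.

Lemma rcpoly_deriv p : (rcpoly p)^`() = rcpoly p^`().
Proof. exact: deriv_map. Qed.

Lemma rcpoly_risfac n z : (rcpoly (risfac R n)).[z] = \prod_(j < n.+1) (z + j%:R).
Proof.
rewrite /rcpoly /risfac rmorph_prod horner_prod; apply: eq_bigr => j _.
by rewrite rmorphD /= map_polyX map_polyC /= hornerD hornerX hornerC rmorph_nat.
Qed.

Lemma rcpoly_linprod (a : nat -> R) n z :
  (rcpoly (linprod a n)).[z] = \prod_(k < n) (1 + RtoC (a k) * z).
Proof.
rewrite /rcpoly /linprod rmorph_prod horner_prod; apply: eq_bigr => j _.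
by rewrite rmorphD /= rmorph1 map_polyZ map_polyX hornerD hornerZ hornerX hornerC.
Qed.

Lemma Ginv_qdiff_poly n z : qdiff (@Ginv R n) z
  (cexp (RtoC (- ln n%:R) * z) / n`!%:R * (rcpoly (critp R n)).[z]).
Proof.
have r0 : 0 <= nm z + 1 by rewrite addr_ge0 ?nm_ge0.
have [K HK] := poly_jet (rcpoly (risfac R n)) r0.
pose c : C := RtoC (- ln n%:R).
have [K' K0' HK'] := jet_cexp (nm c * (nm z + 1)).
have h := jet_mul (jet_mul HK (jet_scale K0' (lexx (nm c)) (lexx _) HK'))
  (jet_cst (nm z + 1) (n`!%:R^-1)).
have zr : nm z < nm z + 1 by rewrite ltrDl.
have := jet_qdiff zr h.
set f := fun z => _; set d := (X in qdiff _ _ X).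
have -> : f = Ginv n.
  apply/funext => w; rewrite /f /Ginv rcpoly_risfac invfM -cexpN /c RtoCN.
  by rewrite mulNr [w * RtoC _]mulrC; ring.
suff -> : d = cexp (c * z) / n`!%:R * (rcpoly (critp R n)).[z] by [].
rewrite /d rcpoly_deriv /critp /rcpoly rmorphB rmorphM /= map_polyC /=.
rewrite hornerD hornerN hornerM hornerC mulr0 addr0.
have -> : real_complex R (ln n%:R) = - c by rewrite /c RtoCN opprK.
by ring.
Qed.

(** By [crit_sum_inv] the convergence factors contribute the exponent [(ln n - 2 * harm n) * z].
    Since the power of [n] has exponent [- ln n * z], what remains is [2 * gam n * z]. *)
Lemma Ginv_qdiff al n z : crit_enum al -> (4 <= n)%N -> qdiff (@Ginv R n) z
  (cexp (2 * RtoC (gam R n) * z) * \prod_(k < n.+1) (1 + (Efac (z / RtoC (al n k)) - 1))).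
Proof.
move=> Hal n4; under eq_bigr do rewrite addrC subrK.
have := Ginv_qdiff_poly n z; set d := (X in qdiff _ _ X).
suff -> : d = cexp (2 * RtoC (gam R n) * z) * \prod_(k < n.+1) Efac (z / RtoC (al n k)) by [].
rewrite /d (critp_linprod Hal n4) /rcpoly map_polyZ hornerZ rcpoly_linprod.
rewrite prod_Efac (crit_sum_inv Hal n4).
have -> : \prod_(k < n.+1) (1 - z / RtoC (al n k)) =
          \prod_(k < n.+1) (1 + RtoC (- (al n k)^-1) * z).
  by apply: eq_bigr => k _; rewrite RtoCN RtoCV mulNr mulrC.
set P := \prod_(k < n.+1) _.
rewrite rmorph_nat.
have f0 : n`!%:R != 0 :> C by rewrite pnatr_eq0 -lt0n fact_gt0.
have -> : cexp (RtoC (- ln n%:R) * z) =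
   cexp (2 * RtoC (gam R n) * z) * cexp (z * RtoC (ln n%:R - 2 * harm R n)).
  rewrite -cexpD /gam RtoCN !RtoCB RtoCM RtoCn; congr cexp; ring.
by field.
Qed.

(** Each root sequence lives in a compact interval, so one ultrafilter makes all of them converge at
    once, without diagonal extraction. *)
Lemma crit_limit : exists (U : set_system nat) (al : nat -> nat -> R) (ak : nat -> R),
  [/\ ProperFilter U, \oo `<=` U, crit_enum al,
      forall k, (fun n => al n k) @ U --> ak k & forall k, lo R k <= ak k <= hi R k].
Proof.
have [U [UU sU]] := ultraFilterLemma (@eventually_filter).
have [al Hal] := crit_enum_ex R.
have H k : exists l : R, (fun n => al n k) @ U --> l /\ lo R k <= l <= hi R k.
  have := @segment_compact R (lo R k) (hi R k); rewrite compact_ultra => Hc.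
  (* The image of an ultrafilter is an ultrafilter: of a preimage and its complement one belongs to
     [U]. *)
  have FU : UltraFilter ((fun n => al n k) @ U).
    split; first exact: fmap_proper_filter.
    move=> G GF sG; apply/funext => A; apply/propext; split; last exact: sG.
    move=> GA; have [//|] := in_ultra_setVsetC ((fun n => al n k) @^-1` A) UU.
    move=> /(sG (~` A)) GnA; exfalso; apply: (@filter_not_empty _ G GF).
    by rewrite -(setICr A); apply: filterI.
  have [|l [l1 l2]] := Hc _ FU.
    apply: filterS (filterI (cvg_oo_sub sU 4) (cvg_oo_sub sU k)) => n [n4 nk].
    by have [h _] := Hal n k n4 nk; rewrite /= in_itv.
  by exists l; split => //; move: l1; rewrite /= in_itv.
have [ak Hak] := choice H; exists U, al, ak; split => //.
- exact: ultra_proper.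
- by move=> k; have [] := Hak k.
- by move=> k; have [] := Hak k.
Qed.

Section Limit.
Variables (U : set_system nat) (al : nat -> nat -> R) (ak : nat -> R).
Hypotheses (UF : ProperFilter U) (sU : \oo `<=` U) (Hal : crit_enum al).
Hypotheses (Hak : forall k, (fun n => al n k) @ U --> ak k).
Hypothesis (Hlim : forall k, lo R k <= ak k <= hi R k).

(** The derivative of 1/Gamma, equal to - psi/Gamma off the poles. *)
Definition Gder z : C := cexp (2 * RtoC (euler_gamma R) * z) * canlim ak z.

Lemma ak_ge k : k.+1%:R / 8 <= `|ak k|.
Proof. exact: lo_hi_norm (Hlim k). Qed.

Lemma ak_neq0 k : ak k != 0.
Proof. by rewrite -normr_gt0; apply: lt_le_trans (ak_ge k); rewrite divr_gt0 // ltr0n. Qed.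

Lemma Ginv_der_cvg z :
  (fun n => cexp (2 * RtoC (gam R n) * z) *
     \prod_(k < n.+1) (1 + (Efac (z / RtoC (al n k)) - 1)))
  @ U --> Gder z.
Proof.
have [K K0 HK] := Efac_sqr_bound (nm_ge0 z).
apply: cvgM.
  have h : (fun n => 2 * RtoC (gam R n) * z) @ \oo --> 2 * RtoC (euler_gamma R) * z.
    exact: (cvgM (cvgM (cvg_cst _) (RtoC_cvg _ (@gam_cvg R))) (cvg_cst z)).
  exact: (cvg_trans (cvg_app (fun n => cexp (2 * RtoC (gam R n) * z)) sU) (cexp_cvg _ h)).
apply: (@prod_tannery R U UF (fun n k => Efac (z / RtoC (al n k)) - 1)
  (fun k => Efac (z / RtoC (ak k)) - 1) _ K 4 sU K0).
- move=> n n4; apply: HK => // k kn.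
  by have [/lo_hi_norm] := Hal n4 kn.
- by move=> n; apply: HK => // k _; apply: ak_ge.
- move=> k; apply: cvgB; last exact: cvg_cst.
  apply: Efac_cvg; apply: (cvgM (cvg_cst z)); apply: cvgV; last exact: RtoC_cvg.
  by apply/eqP => /(@RtoC_inj R) /eqP; apply/negP/ak_neq0.
- exact: (@canprod_cvg R ak z ak_ge).
Qed.

(** The jets give uniform bounds but no formula for the derivative, [Ginv_qdiff] a formula but no
    uniform bound; uniqueness of the derivative joins them before the limit. *)
Lemma Glim_qdiff z : qdiff (@Glim R) z (Gder z).
Proof.
have [|K HK] := @Ginv_jet R (nm z + 1); first by rewrite addr_ge0 ?nm_ge0.
have zr : nm z < nm z + 1 by rewrite ltrDl.
have Hf w : (fun n => Ginv n w) @ U --> Glim w.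
  exact: (cvg_trans (cvg_app (fun n => Ginv n w) sU) (@Ginv_cvg R w)).
pose dn n := cexp (2 * RtoC (gam R n) * z) *
  \prod_(k < n.+1) (1 + (Efac (z / RtoC (al n k)) - 1)).
suff HJ : \forall n \near U, exists2 f1, jet (nm z + 1) K (Ginv n) f1 & f1 z = dn n.
  have H1 : dn @ U --> Gder z by exact: Ginv_der_cvg.
  exact: (qdiff_lim UF HJ Hf H1 zr).
apply: filterS (cvg_oo_sub sU 4) => n n4.
have [f1 Hf1] := HK n (leq_trans (isT : 0 < 4)%N n4); exists f1 => //.
exact: (qdiff_uniq (jet_qdiff zr Hf1) (Ginv_qdiff z Hal n4)).
Qed.

Lemma Gder_derivable z : derivable Gder z 1.
Proof.
have [d /qdiff_is_derive[h _]] := @canlim_qdiff R ak z ak_ge.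
apply: derivableM h.
pose c : C := 2 * RtoC (euler_gamma R).
have [K K0 HK] := jet_cexp (nm c * (nm z + 1)).
have zr : nm z < nm z + 1 by rewrite ltrDl.
by have /qdiff_is_derive[] := jet_qdiff zr (jet_scale K0 (lexx (nm c)) (lexx _) HK).
Qed.

Lemma Gder_eq0 z : Gder z = 0 <-> exists k, z = RtoC (ak k).
Proof.
rewrite -(canlim_eq0 _ ak_ge) /Gder; split => [/eqP|->]; last by rewrite mulr0.
by rewrite mulf_eq0 (negPf (cexp_neq0 _)) => /eqP.
Qed.

Lemma Glim_cts z : @Glim R w @[w --> z] --> Glim z.
Proof. exact: qdiff_cts (Glim_qdiff z). Qed.

(** Continuity keeps [Glim] away from 0 near [z], so [Gamma] can be differentiated as a
    reciprocal. *)
Lemma near_Gamma z : ~ nonpos_int z -> \forall w \near z, (Glim w)^-1 = Gamma w.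
Proof.
move=> nz; have G0 : Glim z != 0 by apply/eqP => /Glim_eq0.
have /cvg_nmP/(_ (nm (Glim z) / 2)) := @Glim_cts z.
have p0 : 0 < nm (Glim z) by apply: nm_gt0; apply/eqP.
have p2 : 0 < nm (Glim z) / 2 by rewrite divr_gt0.
move=> /(_ p2); apply: filterS => w; have [E|] := eqVneq (Glim w) 0.
  by rewrite E subr0 => h; exfalso; lra.
by move=> /eqP w0 _; rewrite Gamma_Glim // => /Glim_eq0.
Qed.

Lemma Gamma_derive1 z : ~ nonpos_int z -> derive1 (@Gamma R) z = - Gder z / Glim z ^+ 2.
Proof.
move=> nz; have G0 : Glim z != 0 by apply/eqP => /Glim_eq0.
have [dG DG] := qdiff_is_derive (Glim_qdiff z).
rewrite derive1E -(near_eq_derive _ (near_Gamma nz)) deriveV // DG.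
by rewrite [_ *: _]mulrC mulrN mulNr.
Qed.

Lemma digammaE z : ~ nonpos_int z -> digamma z = - Gder z / Glim z.
Proof.
move=> nz; rewrite /digamma Gamma_derive1 // Gamma_Glim // invrK.
have : Glim z != 0 by apply/eqP => /Glim_eq0.
by move=> g0; field.
Qed.

(** The limits stay in closed intervals that contain no non-positive integer. *)
Lemma ak_nonpos k : ~ nonpos_int (RtoC (ak k)).
Proof.
move=> [n h]; have {}h : ak k = - n%:R by apply: (@RtoC_inj R); rewrite h RtoCN RtoCn.
have /andP[h1 h2] := Hlim k; have := lo_gt R k.
case: k h h1 h2 => [|k] h /= h1 h2 h3; first by have : 0 <= n%:R :> R by []; lra.
have a : n%:R < k.+1%:R :> R by lra.
have : k.+1%:R < (n.+1)%:R :> R by rewrite -[n.+1%:R]natr1; lra.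
move: a; rewrite !ltr_nat => a b; by have := leq_trans a b; rewrite ltnn.
Qed.

Lemma digamma_zerosE : range (fun k => RtoC (ak k)) = @digamma_zeros R.
Proof.
apply/seteqP; split => w.
  move=> [k _ <-]; split; first exact: ak_nonpos.
  rewrite digammaE; last exact: ak_nonpos.
  by have -> : Gder (RtoC (ak k)) = 0; [apply/Gder_eq0; exists k|rewrite oppr0 mul0r].
move=> [nw]; rewrite digammaE // => /eqP; rewrite mulf_eq0 oppr_eq0 invr_eq0 => /orP[] /eqP.
  by move=> /Gder_eq0[k ->]; exists k.
by move=> /Glim_eq0.
Qed.

Lemma ak_decr k : ak k.+1 < ak k.
Proof.
have /andP[_ h1] := Hlim k.+1; have /andP[h2 _] := Hlim k.
by have := hi_lt_lo R (ltnSn k); lra.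
Qed.

End Limit.
End Derivative.

(** * Uniqueness of the enumeration and of the entire extension *)

Section Uniqueness.
Variable R : realType.
Local Notation C := (Cplx R).

(** Strong induction: [c n] equals some [d m], and [m < n] would give [c n = c m]; hence [m >= n]
    and [c n <= d n], then by symmetry equality. *)
Lemma decr_range_uniq (a b : nat -> R) : (forall k, a k.+1 < a k) -> (forall k, b k.+1 < b k) ->
  range (fun k => RtoC (a k)) = range (fun k => RtoC (b k)) -> a = b.
Proof.
move=> da db E.
have mono (c : nat -> R) : (forall k, c k.+1 < c k) -> forall i j, (i < j)%N -> c j < c i.
  move=> dc i j; elim: j => // j IH; rewrite ltnS leq_eqVlt => /orP[/eqP ->//|/IH].
  exact: lt_trans.
have inc (c d : nat -> R) : (forall k, c k.+1 < c k) -> (forall k, d k.+1 < d k) ->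
    range (fun k => RtoC (c k)) = range (fun k => RtoC (d k)) ->
    forall n, (forall k, (k < n)%N -> c k = d k) -> c n <= d n.
  move=> dc dd Ecd n Hn.
  have : range (fun k => RtoC (d k)) (RtoC (c n)) by rewrite -Ecd; exists n.
  move=> [m _ /(@RtoC_inj R) h]; rewrite -h.
  case: (ltngtP m n) => [mn|nm|->//]; last by rewrite ltW ?mono.
  by have := mono c dc _ _ mn; rewrite (Hn m mn) h ltxx.
apply/funext => n; elim/ltn_ind: n => n IH; apply/le_anti; rewrite !inc // => k kn.
by rewrite IH.
Qed.

(* A non-positive integer is a limit of points that are not integers. *)
Lemma entire_ext_uniq (F G : C -> C) : (forall z, derivable F z 1) ->
  (forall z, derivable G z 1) -> (forall z, ~ nonpos_int z -> F z = G z) -> F = G.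
Proof.
move=> dF dG E; apply/funext => z.
have [[n zE]|] := pselect (nonpos_int z); last exact: E.
have cF := derivable_cts (dF z).
have cG := derivable_cts (dG z).
(* Starting at 1/2 keeps the shift strictly between 0 and 1, so [h m] is never an integer. *)
pose h m : C := z + RtoC (m.+2%:R^-1).
have hz : h @ \oo --> z.
  apply/cvg_nmP => e e0; have [N HN] := small_tail 1 e0; exists N => // m /= Nm.
  rewrite /h opprD addNKr nmN nmR ger0_norm //; apply: le_trans (HN m Nm).
  by rewrite div1r lef_pV2 ?posrE ?ltr0n // ler_nat.
have hE m : F (h m) = G (h m).
  apply: E => -[k hk]; have : m.+2%:R^-1 = n%:R - k%:R :> R.
    apply: (@RtoC_inj R); rewrite RtoCB !RtoCn.
    by move: hk; rewrite /h zE => /(canRL (addKr _)) ->; rewrite opprK.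
  have i0 : 0 < m.+2%:R^-1 :> R by rewrite invr_gt0 ltr0n.
  have i1 : m.+2%:R^-1 < 1 :> R by rewrite invf_lt1 ?ltr1n ?ltr0n.
  move=> x; rewrite x in i0 i1; have a : k%:R < n%:R :> R by lra.
  have b : n%:R < k.+1%:R :> R by rewrite -natr1; lra.
  by move: a b; rewrite !ltr_nat => a b; have := leq_trans b a; rewrite ltnn.
have h1 : (F \o h) @ \oo --> F z by apply: cvg_comp hz cF.
have h2 : (G \o h) @ \oo --> G z by apply: cvg_comp hz cG.
have FG : F \o h = G \o h by apply/funext => m; apply: hE.
rewrite FG in h1.
by rewrite -(cvg_lim (@norm_hausdorff _ _) h1) (cvg_lim (@norm_hausdorff _ _) h2).
Qed.

End Uniqueness.

(** * The product formula for psi/Gamma *)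

Unset Implicit Arguments.

Theorem theorem1 (R : realType) (z : Cplx R) :
  let partial_product (n : nat) : Cplx R :=
    \prod_(k < n) ((1 - z / RtoC (digamma_zero R k)) *
                   cexp (z / RtoC (digamma_zero R k))) in
  cvgn partial_product /\
  digamma_div_Gamma z =
    - cexp (2 * RtoC (euler_gamma R) * z) * limn partial_product.
Proof.
have [U [al [ak [UF sU Hal Hak Hlim]]]] := crit_limit R.
(* The sequence picked by [get] is known only through its defining property; [ak] witnesses
   existence, and uniqueness identifies the two. *)
have akE : digamma_zero R = ak.
  have h : exists a : nat -> R, (forall k, a k.+1 < a k) /\
      range (fun k => RtoC (a k)) = @digamma_zeros R.
    by exists ak; split; [exact: ak_decr Hlim | exact: (digamma_zerosE UF sU Hal Hak Hlim)].
  have [d1 d2] := getPex h.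
  apply: (decr_range_uniq d1 (ak_decr Hlim)).
  by rewrite d2 (digamma_zerosE UF sU Hal Hak Hlim).
move=> pp; have ppE : pp = fun n => canprod ak n z.
  apply/funext => n; rewrite /pp akE; apply: eq_bigr => k _.
  by rewrite [RHS]addrC subrK.
have Hpp : (fun n => canprod ak n z) @ \oo --> canlim ak z.
  by apply: canprod_cvg; apply: ak_ge Hlim.
split; first by rewrite ppE; apply/cvg_ex; exists (canlim ak z).
(* Likewise [- Gder ak] is an entire extension, hence the chosen one. *)
have FE : @digamma_div_Gamma R = (fun w => - Gder ak w).
  have D : forall w, derivable (fun w : Cplx R => - Gder ak w) w 1.
    by move=> w; apply: derivableN; apply: Gder_derivable.
  have E w : ~ nonpos_int w -> - Gder ak w = digamma w / Gamma w.
    move=> nw; rewrite (digammaE UF sU Hal Hak Hlim) // Gamma_Glim // invrK.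
    by rewrite divfK //; apply/eqP => /Glim_eq0.
  have h : exists F : Cplx R -> Cplx R, (forall z : Cplx R, derivable F z 1) /\
      (forall z, ~ nonpos_int z -> F z = digamma z / Gamma z) by exists (fun w => - Gder ak w).
  have [d1 d2] := getPex h.
  by apply: (entire_ext_uniq d1 D) => w nw; rewrite d2 // E.
by rewrite FE ppE /Gder mulNr.
Qed.
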